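(* Let $a:\Omega\to\mathbb C\setminus\{0\}$ be holomorphic, and define, for $x\in\Omega$, $$\tilde D_a(x)=\begin{pmatrix}a(x)&0\\ 0&1/a(x)\end{pmatrix}x\begin{pmatrix}a(x)&0\\ 0&1/a(x)\end{pmatrix}^{-1}.$$ If $\tilde D_a$ is a holomorphic automorphism of $\Omega$, then $a=\exp(\tilde a/2)$ for some holomorphic $\tilde a:\Omega\to\mathbb C$ that depends only on $x_{11}$, $x_{22}$ and $x_{12}x_{21}$.
   Context: $\Omega=\Omega_2$ is the spectral ball, i.e. the domain of all $2\times2$ complex matrices $x=\begin{pmatrix}x_{11}&x_{12}\\ x_{21}&x_{22}\end{pmatrix}$ whose spectral radius is less than $1$. An automorphism of $\Omega$ is a biholomorphic self-map of $\Omega$. *)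

(* Defs.v *)
From HB Require Import structures.
From mathcomp Require Import all_boot all_order all_algebra.
From mathcomp Require Import complex.
From mathcomp Require Import all_classical all_reals all_analysis.

Set Implicit Arguments.
Unset Strict Implicit.
Unset Printing Implicit Defensive.

Import Order.TTheory GRing.Theory Num.Theory.
Import numFieldNormedType.Exports.

Local Open Scope classical_set_scope.
Local Open Scope ring_scope.

(* For [R : realType], [R[i]] is the field of complex numbers; as a normed
   space over itself it is written [R[i]^o]. *)

(* [complex.Re `|l|] is the modulus of [l] as an element of [R]: the norm of
   [R[i]] takes its values in [R[i]]. *)
Definition spectral_radius (R : realType) (n : nat) (x : 'M[R[i]]_n) : R :=
  sup [set complex.Re `|l| | l in [set l : R[i] | eigenvalue x l]].

Definition spectral_ball (R : realType) (n : nat) : set 'M[R[i]]_n :=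
  [set x | spectral_radius x < 1].
Arguments spectral_ball : clear implicits.

(* Functions are total and their values outside [D] are irrelevant: [D] is
   meant to be open, so that [differentiable f x], complex Frechet
   differentiability, only depends on [f] near [x], inside [D]. *)
Definition holomorphic_on (R : realType) (V W : normedModType R[i])
    (D : set V) (f : V -> W) : Prop :=
  forall x, D x -> differentiable f x.

Definition holomorphic_automorphism (R : realType) (V : normedModType R[i])
    (D : set V) (f : V -> V) : Prop :=
  holomorphic_on D f /\
  exists g : V -> V,
    [/\ holomorphic_on D g,
        set_fun D D f, set_fun D D g,
        {in D, cancel f g} & {in D, cancel g f}].

Definition cexp (R : realType) (z : R[i]) : R[i] :=
  (expR (complex.Re z))%:C%C *
  (cos (complex.Im z) +i* sin (complex.Im z))%C.

Definition diag_inv (R : realType) (c : R[i]) : 'M[R[i]]_2 :=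
  diag_mx (\row_(j < 2) if j == 0 then c else c^-1).

Definition Dtilde (R : realType) (a : 'M[R[i]]_2 -> R[i]^o)
    (x : 'M[R[i]]_2) : 'M[R[i]]_2 :=
  diag_inv (a x) *m x *m invmx (diag_inv (a x)).

(* Main.v *)
Require Import Defs.
From mathcomp Require Import all_boot all_order all_algebra.
From mathcomp Require Import complex.
From mathcomp Require Import all_classical all_reals all_analysis.
From mathcomp Require Import ring lra.

Import Order.TTheory GRing.Theory Num.Theory.
Import numFieldNormedType.Exports.
Import ComplexField.Normc.

Local Open Scope classical_set_scope.
Local Open Scope ring_scope.

(** Conjugation by diag (a, 1/a) fixes x11 and x22, multiplies x12 by a^2 and
    divides x21 by a^2. It therefore maps every orbit of the torus action
    z.x = (x11, z x12; x21 / z, x22), z <> 0, to itself.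

    The spectral ball is star-shaped at 0, so a = exp f for a holomorphic f
    ([holomorphic_log]); put b = 2 f, so that a^2 = exp b. On the orbit of x,
    with h (z) = b (z.x), the automorphism reads z |-> z exp (h z), a self-map
    of the punctured plane, and its inverse reads z |-> z exp (k z) for another
    holomorphic k. An automorphism of the punctured plane is c z or c / z, and
    the logarithm h excludes the second kind; so h is constant
    ([twist_inverse_constant]) and b is constant on orbits
    ([torus_orbit_constant]). The matrices with given x11, x22 and
    m = x12 x21 form a single orbit if m <> 0; if m = 0, all their orbits
    accumulate at diag (x11, x22), and continuity of b concludes
    ([torus_limit_constant]).

    That h is constant is proved with one consequence of Goursat's theorem,
    [circle_mean]: in the coordinate log z, Goursat's theorem on rectangles
    shows that the mean over a circle around 0 does not depend on the radius,
    also across a point where the function is only continuous. Applied to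
    difference quotients, it yields a Schwarz lemma at 0 ([schwarz_at0]) and
    Liouville's theorem on the punctured plane ([liouville_punctured]). Let
    f z = z exp (h z) and let g be its inverse. Since g maps compact annuli to
    compact subsets of the punctured plane, f avoids any given compact annulus
    close to 0, hence tends to 0 or to infinity there. In the second case the
    Schwarz lemma for exp (- h / 4) gives 1 / f = O (z^3), and for
    v |-> g (1 / v) it gives z = O (1 / f): a contradiction. So f and g are O (z) at 0, which bounds Re h near 0, and
    near infinity by inversion; then exp (h / N) is bounded, hence constant,
    for every N.

    The logarithm of a is obtained along the rays t |-> t x as a finite sum of
    principal logarithms of ratios of values of a at close points; by
    compactness one subdivision serves a whole neighbourhood of x. *)

(** * Modulus, continuity and differentiability on the complex numbers *)

Section ComplexModulus.
Context {R : realType}.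
Implicit Types z w : R[i].

Lemma normE z : `|z| = (normc z)%:C%C.
Proof. by case: z. Qed.

Lemma normc_ge0 z : 0 <= normc z.
Proof. by case: z => a b; exact: sqrtr_ge0. Qed.

Lemma normcD z w : normc (z + w) <= normc z + normc w.
Proof. exact: (@le_normcD R). Qed.

Lemma normc_opp z : normc (- z) = normc z.
Proof. exact: (@normcN R). Qed.

Lemma normc_distC z w : normc (z - w) = normc (w - z).
Proof. by rewrite -normc_opp opprB. Qed.

Lemma normcB z w : normc (z - w) <= normc z + normc w.
Proof. by rewrite -[normc w]normc_opp; exact: normcD. Qed.

Lemma normcB_ge z w : normc z - normc w <= normc (z - w).
Proof. by have := normcD (z - w) w; rewrite subrK; lra. Qed.

Lemma normc_eq0 z : (normc z == 0) = (z == 0).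
Proof.
by apply/eqP/eqP => [/eq0_normc//|->]; exact: normc0.
Qed.

Lemma normc_gt0 z : (0 < normc z) = (z != 0).
Proof. by rewrite lt_def normc_ge0 andbT normc_eq0. Qed.

Lemma normc_real (x : R) : normc x%:C%C = `|x|.
Proof. by rewrite /normc /= expr0n /= addr0 sqrtr_sqr. Qed.

Lemma normc_nat n : normc n%:R = n%:R :> R.
Proof.
by rewrite -(rmorph_nat (real_complex R)) normc_real ger0_norm.
Qed.

Lemma normcX z n : normc (z ^+ n) = normc z ^+ n.
Proof.
elim: n => [|n IH]; first by rewrite !expr0 normc1.
by rewrite !exprS normcM IH.
Qed.

Lemma normc_Re z : `|complex.Re z| <= normc z.
Proof. by have := normc_ge_Re z; rewrite normE lecR. Qed.

Lemma normc_Im z : `|complex.Im z| <= normc z.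
Proof.
case: z => a b /=; rewrite -sqrtr_sqr ler_wsqrtr// lerDr; exact: sqr_ge0.
Qed.

Lemma normc_le_ReIm z : normc z <= `|complex.Re z| + `|complex.Im z|.
Proof.
rewrite {1}[z]complexE; apply: le_trans (normcD _ _) _.
rewrite normcM !normc_real.
by rewrite {1}/normc /= expr0n expr1n add0r sqrtr1 mul1r.
Qed.

Lemma ReB z w : complex.Re (z - w) = complex.Re z - complex.Re w.
Proof. by case: z; case: w. Qed.

Lemma ImB z w : complex.Im (z - w) = complex.Im z - complex.Im w.
Proof. by case: z; case: w. Qed.

Lemma ReM z w : complex.Re (z * w) =
  complex.Re z * complex.Re w - complex.Im z * complex.Im w.
Proof. by case: z; case: w. Qed.

Lemma ImM z w : complex.Im (z * w) =
  complex.Re z * complex.Im w + complex.Im z * complex.Re w.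
Proof. by case: z; case: w. Qed.

Lemma ReD z w : complex.Re (z + w) = complex.Re z + complex.Re w.
Proof. by case: z; case: w. Qed.

Lemma ImD z w : complex.Im (z + w) = complex.Im z + complex.Im w.
Proof. by case: z; case: w. Qed.

Lemma ReN z : complex.Re (- z) = - complex.Re z.
Proof. by case: z. Qed.

(** The norm of a space over R[i] takes its values in R[i]; radii are brought
    back to R. *)
Lemma nbhsC_P {V : normedModType R[i]} (x : V) (P : set V) :
  nbhs x P <->
  exists2 d : R, 0 < d & forall y, `|y - x| < d%:C%C -> P y.
Proof.
split.
  move=> /nbhs_ballP[[d i]/= d0 H].
  move: d0; rewrite ltcE/= => /andP[/eqP i0 d0]; exists d => // y yx.
  apply: H; rewrite -ball_normE /ball_/= distrC.
  by move: yx; rewrite i0.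
move=> [d d0 H]; apply/nbhs_ballP; exists d%:C%C; first by rewrite /= ltcR.
by move=> y; rewrite -ball_normE /ball_/= distrC; exact: H.
Qed.

(** Continuity and differentiability with real-valued moduli, the form in
    which all estimates below are made; see [ccontP] and [cdiffP]. *)
Definition ccont (f : R[i] -> R[i]) z := forall e : R, 0 < e ->
  exists2 d : R, 0 < d & forall w, normc (w - z) < d -> normc (f w - f z) < e.

Definition cdiff (f : R[i] -> R[i]) z := exists l, forall e : R, 0 < e ->
  exists2 d : R, 0 < d & forall w, normc (w - z) < d ->
    normc (f w - f z - l * (w - z)) <= e * normc (w - z).

Lemma nbhs_normcP z (P : set R[i]) :
  nbhs (z : R[i]^o) P <->
  exists2 d : R, 0 < d & forall w, normc (w - z) < d -> P w.
Proof.
rewrite nbhsC_P; split=> -[d d0 H]; exists d => // w zw; apply: H.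
  by rewrite [`|_|]normE ltcR.
by move: zw; rewrite [`|_|]normE ltcR.
Qed.

Lemma ccontP (f : R[i]^o -> R[i]^o) (z : R[i]^o) :
  ccont f z <-> {for z, continuous f}.
Proof.
split.
  move=> H A /nbhs_normcP[e e0 HA]; apply/nbhs_normcP.
  by have [d d0 Hd] := H _ e0; exists d => // w /Hd; exact: HA.
move=> H e e0; have : nbhs (f z : R[i]^o) [set w | normc (w - f z) < e].
  by apply/nbhs_normcP; exists e.
by move=> /H /nbhs_normcP.
Qed.

Lemma cdiffP (f : R[i]^o -> R[i]^o) (z : R[i]^o) :
  cdiff f z <-> differentiable f z.
Proof.
split.
  move=> [l H]; apply/derivable1_diffP; apply/cvg_ex; exists l.
  apply/cvgrPdist_le => [[e i]]; rewrite ltcE/= => /andP[/eqP -> e0].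
  have [d d0 Hd] := H _ e0.
  rewrite near_withinE; apply/nbhs_normcP; exists d => // h.
  rewrite subr0 => hd h0; rewrite [`|_|]normE lecR.
  have nh : normc (h + z - z) < d by rewrite addrK.
  have := Hd _ nh; rewrite addrK => {}nh.
  rewrite -(ler_pM2r (_ : 0 < normc h)) ?normc_gt0//.
  apply: le_trans nh; rewrite -normcM le_eqVlt; apply/orP; left; apply/eqP.
  rewrite -normc_opp; congr normc.
  rewrite /GRing.scale/= mulr1; field.
  exact: h0.
move=> /derivable1_diffP/cvg_ex[l]; set u := (X in X @ _).
move=> /cvgrPdist_le H; exists l => e e0.
have /H : 0 < e%:C%C by rewrite ltcR.
rewrite near_withinE => /nbhs_normcP[d d0 Hd]; exists d => // w wd.
have [->|wz] := eqVneq w z.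
  by rewrite !subrr mulr0 subrr normc0 mulr0.
have wz0 : w - z != 0 by rewrite subr_eq0.
have := Hd (w - z); rewrite subr0 => /(_ wd wz0).
rewrite [`|_|]normE lecR /u -(ler_pM2r (_ : 0 < normc (w - z))) ?normc_gt0//.
apply: le_trans; rewrite -normcM -normc_opp le_eqVlt.
apply/orP; left; apply/eqP; congr normc.
rewrite /GRing.scale/= mulr1 subrK; field.
exact: wz0.
Qed.

Lemma cdiff_cont f z : cdiff f z -> ccont f z.
Proof. by move=> /cdiffP/differentiable_continuous/ccontP. Qed.

End ComplexModulus.

(** * The complex exponential *)

Section ComplexExponential.
Context {R : realType}.
Implicit Types z w : R[i].

Lemma Re_cexp z : complex.Re (cexp z) = expR (complex.Re z) * cos (complex.Im z).
Proof. by rewrite /cexp ReM /= mul0r subr0. Qed.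

Lemma Im_cexp z : complex.Im (cexp z) = expR (complex.Re z) * sin (complex.Im z).
Proof. by rewrite /cexp ImM /= mul0r addr0. Qed.

Lemma complex_eq z w :
  complex.Re z = complex.Re w -> complex.Im z = complex.Im w -> z = w.
Proof. by case: z => a b; case: w => c d /= -> ->. Qed.

Lemma cexpD z w : cexp (z + w) = cexp z * cexp w.
Proof.
apply: complex_eq.
  by rewrite [RHS]ReM !(Re_cexp, Im_cexp) ReD ImD expRD cosD; ring.
by rewrite [RHS]ImM !(Re_cexp, Im_cexp) ReD ImD expRD sinD; ring.
Qed.

Lemma cexp0 : cexp 0 = 1 :> R[i].
Proof.
by apply: complex_eq; rewrite ?(Re_cexp, Im_cexp) /= expR0 ?cos0 ?sin0 !mul1r.
Qed.

Lemma normc_cexp z : normc (cexp z) = expR (complex.Re z).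
Proof.
rewrite /cexp normcM normc_real ger0_norm ?expR_ge0//=.
by rewrite cos2Dsin2 sqrtr1 mulr1.
Qed.

Lemma cexp_neq0 z : cexp z != 0.
Proof. by rewrite -normc_gt0 normc_cexp expR_gt0. Qed.

Lemma cexpN z : cexp (- z) = (cexp z)^-1.
Proof.
by apply: (mulfI (cexp_neq0 z)); rewrite -cexpD subrr cexp0 divff ?cexp_neq0.
Qed.

Lemma cexpB z w : cexp (z - w) = cexp z / cexp w.
Proof. by rewrite cexpD cexpN. Qed.

Lemma cexpMn n z : cexp (n%:R * z) = cexp z ^+ n.
Proof.
elim: n => [|n IH]; first by rewrite mul0r cexp0.
by rewrite -natr1 mulrDl mul1r cexpD IH exprSr.
Qed.

Lemma cexp_2ipi : cexp ((0 +i* (pi *+ 2))%C : R[i]) = 1.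
Proof.
by apply: complex_eq; rewrite ?(Re_cexp, Im_cexp) /= expR0 ?cos2pi ?sin2pi mul1r.
Qed.

Lemma cexp_eq1 w : cexp w = 1 -> `|complex.Im w| < pi *+ 2 -> w = 0.
Proof.
move=> w1 wpi.
have Rew : complex.Re w = 0.
  apply/eqP; have := congr1 (@normc R) w1.
  by rewrite normc_cexp normc1 -expR0 => /expR_inj ->.
apply: complex_eq => //=.
have : cos (complex.Im w) = 1.
  by have := congr1 (@complex.Re R) w1; rewrite Re_cexp Rew expR0 mul1r.
rewrite -(cos_norm (complex.Im w)); set y := `|_| in wpi *.
have y0 : 0 <= y by exact: normr_ge0.
move=> cy; apply/eqP; rewrite -normr_eq0 -/y; apply: contraTT isT => yn0.
have {yn0}y0 : 0 < y by rewrite lt_def y0 yn0.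
have : 0 < sin (y / 2).
  by apply: sin_gt0_pi; apply/andP; split; move: wpi; rewrite mulr2n; lra.
have : cos (y / 2 *+ 2) = 1 by rewrite -mulr_natr divfK.
rewrite cos_mulr2n cos2sin2 mulr2n => h s0.
have : sin (y / 2) ^+ 2 = 0 by lra.
by move=> /eqP; rewrite expf_eq0/= => /eqP s00; move: s0; rewrite s00 ltxx.
Qed.

Lemma cexp_inj z w : cexp z = cexp w ->
  `|complex.Im z - complex.Im w| < pi *+ 2 -> z = w.
Proof.
move=> zw; rewrite -ImB => /cexp_eq1 h; apply/eqP; rewrite -subr_eq0; apply/eqP.
by apply: h; rewrite cexpB zw divff// cexp_neq0.
Qed.

(** Polar coordinates, with the argument normalised to [- pi, pi]. *)
Lemma cexp_surj z : z != 0 -> exists w,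
  [/\ cexp w = z, complex.Re w = ln (normc z) & `|complex.Im w| <= pi].
Proof.
move=> z0; have nz : 0 < normc z by rewrite normc_gt0.
pose c := complex.Re z / normc z; pose s := complex.Im z / normc z.
have cs : c ^+ 2 + s ^+ 2 = 1.
  have : normc z ^+ 2 = complex.Re z ^+ 2 + complex.Im z ^+ 2.
    by case: (z) => a b /=; rewrite sqr_sqrtr// addr_ge0// sqr_ge0.
  move=> h; rewrite !expr_div_n -mulrDl -h divff//.
  by rewrite expf_eq0/= (gt_eqF nz).
have c1 : -1 <= c <= 1.
  rewrite -ler_norml -sqrtr_sqr -[leRHS]sqrtr1 ler_wsqrtr// -cs lerDl.
  exact: sqr_ge0.
have [/acos_ge0 t0 /acos_lepi tpi] := (c1, c1).
have ct : cos (acos c) = c by apply: acosK; rewrite in_itv.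
have st : sin (acos c) = `|s|.
  by rewrite sin_acos// -cs [c ^+ 2 + _]addrC addrK sqrtr_sqr.
have key y : cos y = c -> sin y = s -> cexp (ln (normc z) +i* y)%C = z.
  move=> cy sy; apply: complex_eq; rewrite ?(Re_cexp, Im_cexp)/= lnK ?posrE//.
    by rewrite cy /c mulrC divfK// gt_eqF.
  by rewrite sy /s mulrC divfK// gt_eqF.
have [s0|s0] := leP 0 s.
  exists (ln (normc z) +i* acos c)%C; split => //=.
    by apply: key => //; rewrite st ger0_norm.
  by rewrite ger0_norm.
exists (ln (normc z) +i* (- acos c))%C; split => //=.
  by apply: key; rewrite ?cosN// sinN st ltr0_norm// opprK.
by rewrite normrN ger0_norm.
Qed.

Lemma is_derive_eps (f : R -> R) (x l : R) : is_derive x 1 f l ->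
  forall e, 0 < e -> exists2 d, 0 < d & forall y, `|y - x| < d ->
    `|f y - f x - l * (y - x)| <= e * `|y - x|.
Proof.
move=> [df fl] e e0.
have : h^-1 *: (f (h + x) - f x) @[h --> 0^'] --> l.
  rewrite -fl; have := df; rewrite /derivable /derive.
  by under eq_fun do rewrite [_%:A]mulr1.
move=> /cvgrPdist_le /(_ _ e0); rewrite near_withinE.
move=> /nbhs_ballP[d /= d0 Hd]; exists d => // y yx.
have [->|yx0] := eqVneq y x; first by rewrite !subrr mulr0 subrr normr0 mulr0.
have yx1 : y - x != 0 by rewrite subr_eq0.
have := Hd (y - x); rewrite /ball/= sub0r normrN => /(_ yx yx1).
rewrite subrK -(ler_pM2r (_ : 0 < `|y - x|)) ?normr_gt0//.
apply: le_trans; rewrite -normrM -normrN le_eqVlt; apply/orP; left; apply/eqP.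
by congr `|_|; rewrite /GRing.scale/=; field.
Qed.

(** The derivative of [cexp] at 0 is 1, from the real derivatives of exp, cos
    and sin at 0. *)
Lemma cexp_o0 (e : R) : 0 < e -> exists2 d : R, 0 < d &
  forall w, normc w < d -> normc (cexp w - 1 - w) <= e * normc w.
Proof.
move=> e0; have [e1 [e10 e11 e1e]] : exists e1, [/\ 0 < e1, e1 <= 1 & e1 * 7 <= e].
  (* The remainders below add up to e1 |x| + 6 e1 |y|, with |x|, |y| <= |w|. *)
  exists (Num.min 1 (e / 7)); rewrite lt_min ltr01 divr_gt0//.
  by split; rewrite ?ge_min ?lexx// -ler_pdivlMr// ge_min lexx orbT.
have [d1 d10 H1] := @is_derive_eps _ _ _ (is_derive_expR (0 : R)) _ e10.
have [d2 d20 H2] := @is_derive_eps _ _ _ (is_derive_cos (0 : R)) _ e10.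
have [d3 d30 H3] := @is_derive_eps _ _ _ (is_derive_sin (0 : R)) _ e10.
exists (Num.min (Num.min d1 d2) (Num.min d3 (Num.min e1 (1/2)))).
  by rewrite !lt_min d10 d20 d30 e10; lra.
move=> w; rewrite !lt_min => /andP[/andP[w1 w2] /and3P[w3 we wh]].
set x := complex.Re w; set y := complex.Im w.
have xw : `|x| <= normc w := normc_Re w.
have yw : `|y| <= normc w := normc_Im w.
have := H1 x; rewrite !subr0 expR0 mul1r => /(_ (le_lt_trans xw w1)) {}H1.
have := H2 y; rewrite !subr0 cos0 sin0 oppr0 mul0r subr0.
move=> /(_ (le_lt_trans yw w2)) {}H2.
have := H3 y; rewrite !subr0 sin0 cos0 mul1r subr0.
move=> /(_ (le_lt_trans yw w3)) {}H3.
apply: le_trans (normc_le_ReIm _) _.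
have -> : complex.Re (cexp w - 1 - w) =
    (expR x - 1 - x) + expR x * (cos y - 1).
  by rewrite !ReB Re_cexp -/x -/y /=; ring.
have -> : complex.Im (cexp w - 1 - w) =
    expR x * (sin y - y) + (expR x - 1) * y.
  by rewrite !ImB Im_cexp -/x -/y /=; ring.
have ex1 : `|expR x - 1| <= 2 * `|x|.
  have -> : expR x - 1 = (expR x - 1 - x) + x by ring.
  apply: le_trans (ler_normD _ _) _.
  have : e1 * `|x| <= `|x| by rewrite ler_piMl.
  by lra.
have ex2 : `|expR x| <= 2.
  have -> : expR x = (expR x - 1) + 1 by ring.
  by apply: le_trans (ler_normD _ _) _; rewrite normr1; lra.
have A1 : `|expR x * (cos y - 1)| <= 2 * (e1 * `|y|).
  by rewrite normrM ler_pM.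
have A2 : `|expR x * (sin y - y)| <= 2 * (e1 * `|y|).
  by rewrite normrM ler_pM.
have A3 : `|(expR x - 1) * y| <= 2 * (e1 * `|y|).
  by rewrite normrM mulrA ler_pM// (le_trans ex1)// ler_pM2l//; lra.
apply: le_trans (lerD (ler_normD _ _) (ler_normD _ _)) _.
apply: le_trans (_ : e1 * `|x| + 6 * (e1 * `|y|) <= _); first by lra.
have B1 : e1 * `|x| <= e1 * normc w by rewrite ler_pM2l.
have B2 : e1 * `|y| <= e1 * normc w by rewrite ler_pM2l.
have : e1 * 7 * normc w <= e * normc w by rewrite ler_wpM2r// normc_ge0.
by lra.
Qed.

Lemma cdiff_cexp z : cdiff (@cexp R) z.
Proof.
exists (cexp z) => e e0.
have [|d d0 H] := @cexp_o0 (e / expR (complex.Re z)).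
  by rewrite divr_gt0// expR_gt0.
exists d => // w /H {}H.
have -> : cexp w - cexp z - cexp z * (w - z) =
    cexp z * (cexp (w - z) - 1 - (w - z)).
  rewrite cexpB; field; exact: cexp_neq0.
rewrite normcM normc_cexp mulrC -ler_pdivlMr ?expR_gt0//.
by rewrite mulrAC.
Qed.

End ComplexExponential.

(** * Integrals of continuous functions on segments *)

Section SegmentIntegral.
Context {R : realType}.
Implicit Types (f g : R -> R) (a b c : R).

Definition segint f a b : R :=
  (\int[lebesgue_measure]_(x in `[a, b]) f x)%R.

Lemma continuous_integrable f a b : continuous f ->
  (@lebesgue_measure R).-integrable `[a, b] (EFin \o f).
Proof.
move=> cf; apply: continuous_compact_integrable; first exact: segment_compact.
exact: continuous_subspaceT.
Qed.

Lemma continuous_sub f g : continuous f -> continuous g ->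
  continuous (fun x => f x - g x).
Proof. by move=> cf cg x; apply: cvgB; [exact: cf|exact: cg]. Qed.

Lemma continuous_cst (k : R) : continuous (fun _ : R => k).
Proof. by move=> x; exact: cvg_cst. Qed.

Lemma segint_cat f a b c : continuous f -> a <= b -> b <= c ->
  segint f a c = segint f a b + segint f b c.
Proof.
move=> cf ab bc; have := @Rintegral_itvB R f (BLeft a) (BRight c) b.
move=> /(_ (continuous_integrable _ a c cf)); rewrite !bnd_simp => /(_ ab bc).
rewrite Rintegral_itv_obnd_cbnd; last first.
  apply: integrableS (continuous_integrable _ b c cf) => //.
  by apply: subset_itvr; rewrite bnd_simp.
by rewrite /segint => <-; rewrite addrC subrK.
Qed.

Lemma segintB f g a b : continuous f -> continuous g ->
  segint (fun x => f x - g x) a b = segint f a b - segint g a b.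
Proof.
by move=> cf cg; rewrite /segint RintegralB//; exact: continuous_integrable.
Qed.

Lemma segint_cst k a b : a <= b -> segint (fun=> k) a b = k * (b - a).
Proof.
move=> ab; have mab : fine (@lebesgue_measure R `[a, b]%classic) = b - a.
  rewrite lebesgue_measure_itv/= lte_fin.
  by case: ltgtP ab => //= -> _; rewrite subrr.
by rewrite -mab; exact: Rintegral_cst.
Qed.

Lemma segint_bound f a b k : continuous f -> a <= b ->
  (forall x, a <= x <= b -> `|f x| <= k) -> `|segint f a b| <= k * (b - a).
Proof.
move=> cf ab fk; rewrite -segint_cst// /segint.
apply: le_trans (le_normr_Rintegral _ _) _ => //.
  exact: continuous_integrable.
apply: le_Rintegral => //.
- apply: (@continuous_integrable (fun x => `|f x|)) => x.
  by apply: continuous_comp; [exact: cf|exact: norm_continuous].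
- exact: continuous_integrable (continuous_cst k).
Qed.

End SegmentIntegral.

(** * Circulation along the boundary of a rectangle *)

Section BoundaryCirculation.
Context {R : realType}.

(** Frechet differentiability at (x, y), with partial derivatives [px], [py]. *)
Definition real_diff2 (P : R -> R -> R) (x y px py : R) := forall e, 0 < e ->
  exists2 d, 0 < d & forall x' y', `|x' - x| < d -> `|y' - y| < d ->
    `|P x' y' - P x y - px * (x' - x) - py * (y' - y)|
      <= e * (`|x' - x| + `|y' - y|).

(** The integral of P dx + Q dy along the boundary of [a, b] x [c, d].
    Opposite sides are paired so that only integrals of constants are left
    when P and Q are affine. *)
Definition edge_circulation (P Q : R -> R -> R) (a b c d : R) :=
  segint (fun x => P x c - P x d) a b + segint (fun y => Q b y - Q a y) c d.

Lemma nested_point (u v : nat -> R) : (forall n, u n <= u n.+1) ->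
  (forall n, v n.+1 <= v n) -> (forall n, u n <= v n) ->
  exists x, forall n, u n <= x <= v n.
Proof.
move=> uS vS uv.
have umono m n : (m <= n)%N -> u m <= u n.
  move=> /subnK <-; elim: (n - m)%N => [|k IH]//.
  by rewrite addSn; exact: le_trans IH (uS _).
have vmono m n : (m <= n)%N -> v n <= v m.
  move=> /subnK <-; elim: (n - m)%N => [|k IH]//.
  by rewrite addSn; exact: le_trans (vS _) IH.
have ubv n : ubound (range u) (v n).
  move=> _ [m _ <-]; case: (leqP m n) => [mn|/ltnW nm].
    exact: le_trans (umono _ _ mn) (uv n).
  exact: le_trans (uv m) (vmono _ _ nm).
exists (sup (range u)) => n; apply/andP; split.
  apply: ub_le_sup; last by exists n.
  by exists (v 0%N); exact: ubv.
by apply: ge_sup; [exists (u 0%N), 0%N|exact: ubv].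
Qed.

(** The circulations of the affine parts of P and Q cancel, because the
    partial derivatives dP/dy and dQ/dx at the point agree; only the
    remainders contribute. *)
Lemma real_diff2_circulation P Q x y px py qy :
  (forall y, continuous (P ^~ y)) -> (forall x, continuous (Q x)) ->
  real_diff2 P x y px py -> real_diff2 Q x y py qy ->
  forall e, 0 < e -> exists2 dl, 0 < dl & forall a b c d,
    a <= x <= b -> c <= y <= d -> b - a < dl -> d - c < dl ->
    `|edge_circulation P Q a b c d| <= e * (b - a + (d - c)) ^+ 2.
Proof.
move=> cP cQ dP dQ e e0.
have e20 : 0 < e / 2 by lra.
have [d1 d10 H1] := dP _ e20; have [d2 d20 H2] := dQ _ e20.
exists (Num.min d1 d2); first by rewrite lt_min d10.
move=> a b c d axb cyd; rewrite !lt_min => /andP[ba1 ba2] /andP[dc1 dc2].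
have ab : a <= b by lra.
have cd : c <= d by lra.
pose s := b - a + (d - c).
have key (F : R -> R -> R) (p q dl x' y' : R) : b - a < dl -> d - c < dl ->
    (forall x' y', `|x' - x| < dl -> `|y' - y| < dl ->
    `|F x' y' - F x y - p * (x' - x) - q * (y' - y)|
      <= e / 2 * (`|x' - x| + `|y' - y|)) ->
    a <= x' <= b -> c <= y' <= d ->
    `|F x' y' - F x y - p * (x' - x) - q * (y' - y)| <= e / 2 * s.
  move=> l1 l2 H hx hy.
  have nx : `|x' - x| <= b - a by rewrite ler_norml; lra.
  have ny : `|y' - y| <= d - c by rewrite ler_norml; lra.
  apply: le_trans (H _ _ (le_lt_trans nx l1) (le_lt_trans ny l2)) _.
  by rewrite ler_pM2l// lerD.
have cPP y1 y2 : continuous (fun x => P x y1 - P x y2).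
  by apply: continuous_sub; exact: cP.
have cQQ x1 x2 : continuous (fun y => Q x1 y - Q x2 y).
  by apply: continuous_sub; exact: cQ.
have I1 : `|segint (fun x => P x c - P x d) a b - py * (c - d) * (b - a)|
    <= e * s * (b - a).
  rewrite -segint_cst// -segintB//; last exact: continuous_cst.
  apply: segint_bound => //.
    by apply: continuous_sub; [exact: cPP|exact: continuous_cst].
  move=> x' hx.
  have A := key _ _ _ _ x' c ba1 dc1 H1 hx _.
  have B := key _ _ _ _ x' d ba1 dc1 H1 hx _.
  have -> : P x' c - P x' d - py * (c - d) =
    (P x' c - P x y - px * (x' - x) - py * (c - y)) -
    (P x' d - P x y - px * (x' - x) - py * (d - y)) by ring.
  apply: le_trans (ler_normB _ _) _.
  have -> : e * s = e / 2 * s + e / 2 * s by field.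
  by apply: lerD; [apply: A|apply: B]; lra.
have I2 : `|segint (fun y => Q b y - Q a y) c d - py * (b - a) * (d - c)|
    <= e * s * (d - c).
  rewrite -segint_cst// -segintB//; last exact: continuous_cst.
  apply: segint_bound => //.
    by apply: continuous_sub; [exact: cQQ|exact: continuous_cst].
  move=> y' hy.
  have A := key _ _ _ _ b y' ba2 dc2 H2 _ hy.
  have B := key _ _ _ _ a y' ba2 dc2 H2 _ hy.
  have -> : Q b y' - Q a y' - py * (b - a) =
    (Q b y' - Q x y - py * (b - x) - qy * (y' - y)) -
    (Q a y' - Q x y - py * (a - x) - qy * (y' - y)) by ring.
  apply: le_trans (ler_normB _ _) _.
  have -> : e * s = e / 2 * s + e / 2 * s by field.
  by apply: lerD; [apply: A|apply: B]; lra.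
have -> : e * s ^+ 2 = e * s * (b - a) + e * s * (d - c) by rewrite /s; ring.
apply: le_trans (lerD I1 I2); apply: le_trans (ler_normD _ _).
by rewrite /edge_circulation le_eqVlt; apply/orP; left; apply/eqP; congr `|_|; ring.
Qed.

Definition half (second : bool) (I : R * R) : R * R :=
  let m := (I.1 + I.2) / 2 in if second then (m, I.2) else (I.1, m).

(** The circulation is the sum of the circulations along the four quarters,
    so one of them carries at least a fourth of it. *)
Lemma edge_circulation_quarter P Q a b c d :
  (forall y, continuous (P ^~ y)) -> (forall x, continuous (Q x)) ->
  a <= b -> c <= d -> exists i j,
    let I := half i (a, b) in let J := half j (c, d) in
    `|edge_circulation P Q a b c d| <= 4 * `|edge_circulation P Q I.1 I.2 J.1 J.2|.
Proof.
move=> cP cQ ab cd.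
have cPP y1 y2 : continuous (fun x => P x y1 - P x y2).
  by apply: continuous_sub; exact: cP.
have cQQ x1 x2 : continuous (fun y => Q x1 y - Q x2 y).
  by apply: continuous_sub; exact: cQ.
pose m := (a + b) / 2; pose n := (c + d) / 2.
pose E := edge_circulation P Q.
have E4 : E a b c d = E a m c n + E a m n d + E m b c n + E m b n d.
  have [am mb] : a <= m /\ m <= b by rewrite /m; lra.
  have [cn nd] : c <= n /\ n <= d by rewrite /n; lra.
  rewrite /E /edge_circulation (@segint_cat _ _ a m b)// (@segint_cat _ _ c n d)//.
  by rewrite !segintB//; [ring|exact: cP..].
have nE : `|E a b c d| <= `|E a m c n| + `|E a m n d| + `|E m b c n| + `|E m b n d|.
  rewrite E4; apply: le_trans (ler_normD _ _) _; rewrite lerD2r.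
  by apply: le_trans (ler_normD _ _) _; rewrite lerD2r ler_normD.
have [h1|h1] := leP `|E a b c d| (4 * `|E a m c n|); first by exists false, false.
have [h2|h2] := leP `|E a b c d| (4 * `|E a m n d|); first by exists false, true.
have [h3|h3] := leP `|E a b c d| (4 * `|E m b c n|); first by exists true, false.
have [h4|h4] := leP `|E a b c d| (4 * `|E m b n d|); first by exists true, true.
by exfalso; lra.
Qed.

End BoundaryCirculation.

(** * Goursat's theorem on rectangles *)

Section Goursat.
Context {R : realType}.

Lemma half_le t (I : R * R) : I.1 <= I.2 ->
  [/\ I.1 <= (half t I).1, (half t I).1 <= (half t I).2,
      (half t I).2 <= I.2 & (half t I).2 - (half t I).1 = (I.2 - I.1) / 2].
Proof. by case: I => a b /=; case: t => /= h; split; lra. Qed.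

(** Bisection: from quarter to quarter the circulation loses at most a factor
    4, like the area, while by [real_diff2_circulation] it becomes negligible
    compared to the area around the common point of the quarters. *)
Lemma goursat (P Q : R -> R -> R) a b c d :
  (forall y, continuous (P ^~ y)) -> (forall x, continuous (Q x)) ->
  a <= b -> c <= d ->
  (forall x y, a <= x <= b -> c <= y <= d ->
     exists px py qy, real_diff2 P x y px py /\ real_diff2 Q x y py qy) ->
  edge_circulation P Q a b c d = 0.
Proof.
move=> cP cQ ab cd dPQ.
have /choice[t tP] : forall s : (R * R) * (R * R), exists t : bool * bool,
    s.1.1 <= s.1.2 -> s.2.1 <= s.2.2 ->
    let I := half t.1 s.1 in let J := half t.2 s.2 in
    `|edge_circulation P Q s.1.1 s.1.2 s.2.1 s.2.2|
      <= 4 * `|edge_circulation P Q I.1 I.2 J.1 J.2|.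
  move=> [[a' b'] [c' d']] /=.
  have [ab'|ab'] := leP a' b'; last by exists (true, true).
  have [cd'|cd'] := leP c' d'; last by exists (true, true).
  have [i [j h]] := edge_circulation_quarter _ _ _ _ _ _ cP cQ ab' cd'.
  by exists (i, j).
pose next s := (half (t s).1 s.1, half (t s).2 s.2).
pose s n := iter n next ((a, b), (c, d)).
have sS n : s n.+1 = next (s n) by [].
have sle n : (s n).1.1 <= (s n).1.2 /\ (s n).2.1 <= (s n).2.2.
  elim: n => [//|n [h1 h2]]; rewrite sS /next/=.
  by have [_ ? _ _] := half_le (t (s n)).1 _ h1; have [_ ? _ _] := half_le (t (s n)).2 _ h2.
have sw n : (s n).1.2 - (s n).1.1 = (b - a) / 2 ^+ n /\
            (s n).2.2 - (s n).2.1 = (d - c) / 2 ^+ n.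
  elim: n => [|n [h1 h2]]; first by rewrite expr0 !divr1.
  have [l1 l2] := sle n; rewrite sS /next/= exprS.
  have [_ _ _ ->] := half_le (t (s n)).1 _ l1; have [_ _ _ ->] := half_le (t (s n)).2 _ l2.
  by rewrite h1 h2 [2 * _]mulrC !invfM !mulrA.
have sE n : `|edge_circulation P Q a b c d| <= 4 ^+ n *
    `|edge_circulation P Q (s n).1.1 (s n).1.2 (s n).2.1 (s n).2.2|.
  elim: n => [|n IH]; first by rewrite expr0 mul1r.
  apply: le_trans IH _; rewrite exprSr -mulrA ler_wpM2l ?exprn_ge0//.
  by have [l1 l2] := sle n; exact: tP.
have [x xs] : exists x, forall n, (s n).1.1 <= x <= (s n).1.2.
  apply: nested_point => n; have [l1 l2] := sle n; rewrite ?sS /next//=.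
    by have [] := half_le (t (s n)).1 _ l1.
  by have [] := half_le (t (s n)).1 _ l1.
have [y ys] : exists y, forall n, (s n).2.1 <= y <= (s n).2.2.
  apply: nested_point => n; have [l1 l2] := sle n; rewrite ?sS /next//=.
    by have [] := half_le (t (s n)).2 _ l2.
  by have [] := half_le (t (s n)).2 _ l2.
have [px [py [qy [dP dQ]]]] := dPQ _ _ (xs 0%N) (ys 0%N).
apply/eqP; rewrite -normr_eq0; apply/eqP/le_anti; rewrite normr_ge0 andbT.
pose w := b - a + (d - c); have w0 : 0 <= w by rewrite /w; lra.
apply/ler_addgt0Pl => e e0; rewrite addr0.
have e'0 : 0 < e / (w ^+ 2 + 1) by rewrite divr_gt0// ltr_wpDl// sqr_ge0.
have [dl dl0 H] := real_diff2_circulation _ _ _ _ _ _ _ cP cQ dP dQ _ e'0.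
have [n wn] : exists n, w / 2 ^+ n < dl.
  have [n] : exists n, w / dl < n%:R.
    by exists (Num.bound (w / dl)); apply: archi_boundP; rewrite divr_ge0// ltW.
  move=> hn; exists n; rewrite ltr_pdivrMr ?exprn_gt0// mulrC -ltr_pdivrMr//.
  apply: lt_le_trans hn _; rewrite -natrX ler_nat; exact/ltnW/ltn_expl.
have [w1 w2] := sw n.
have ba : (b - a) / 2 ^+ n <= w / 2 ^+ n.
  by rewrite ler_wpM2r ?invr_ge0 ?exprn_ge0// /w; lra.
have dc : (d - c) / 2 ^+ n <= w / 2 ^+ n.
  by rewrite ler_wpM2r ?invr_ge0 ?exprn_ge0// /w; lra.
apply: le_trans (sE n) _.
have := H _ _ _ _ (xs n) (ys n); rewrite w1 w2.
move=> /(_ (le_lt_trans ba wn) (le_lt_trans dc wn)).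
rewrite -mulrDl -/w => h.
apply: le_trans (_ : 4 ^+ n * (e / (w ^+ 2 + 1) * (w / 2 ^+ n) ^+ 2) <= _).
  by rewrite ler_wpM2l ?exprn_ge0.
have -> : (4 : R) ^+ n = (2 ^+ n) ^+ 2 by rewrite -exprM mulnC exprM; congr (_ ^+ n); rewrite -natrX.
have n0 : (2 : R) ^+ n != 0 by rewrite expf_neq0.
rewrite [leLHS](_ : _ = e * (w ^+ 2 / (w ^+ 2 + 1))); last first.
  by field; rewrite n0 gt_eqF// ltr_wpDl// sqr_ge0.
rewrite ler_piMr ?ltW// ltr_pdivrMr; first by rewrite mul1r ltrDl.
by rewrite ltr_wpDl// sqr_ge0.
Qed.

End Goursat.

(** * Uniformity on compact rectangles *)

Section CompactUniformity.
Context {R : realType}.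

Definition joint_cont (U : R -> R -> R) (x y : R) := forall e, 0 < e ->
  exists2 dl, 0 < dl & forall x' y', `|x' - x| < dl -> `|y' - y| < dl ->
    `|U x' y' - U x y| < e.

Lemma joint_cont_uniform (U : R -> R -> R) x c d :
  (forall y, joint_cont U x y) -> forall e, 0 < e ->
  exists2 dl, 0 < dl & forall x', `|x' - x| < dl ->
    forall y, c <= y <= d -> `|U x' y - U x y| < e.
Proof.
move=> cU e e0; have e20 : 0 < e / 2 by lra.
have := @segment_compact R c d => /compact_near_coveringP.
move=> /(_ R (nbhs x) (fun x' y => `|U x' y - U x y| < e) _).
case.
  move=> y _; have [dl dl0 H] := cU y _ e20.
  exists (ball y dl, ball x dl) => /=.
    by split; exact: nbhsx_ballx.
  move=> [y' x'] [/= hy hx]; rewrite /ball/= distrC in hy.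
  rewrite /ball/= distrC in hx.
  have A := H _ _ hx hy.
  have xx : `|x - x| < dl by rewrite subrr normr0.
  have B := H _ _ xx hy.
  have -> : U x' y' - U x y' = (U x' y' - U x y) - (U x y' - U x y) by ring.
  by apply: le_lt_trans (ler_normB _ _) _; lra.
move=> dl /= dl0 H; exists dl => // x' hx y hy.
by apply: (H x') => /=; rewrite ?in_itv//= /ball/= distrC.
Qed.

Lemma joint_cont_bounded (U : R -> R -> R) a b c d :
  (forall x y, joint_cont U x y) ->
  exists M : R, forall x y, a <= x <= b -> c <= y <= d -> `|U x y| <= M.
Proof.
move=> cU; have := compact_setX (@segment_compact R a b) (@segment_compact R c d).
move=> /compact_near_coveringP /(_ R +oo%R (fun M p => `|U p.1 p.2| <= M) _).
case.
  move=> [x y] _; have [dl dl0 H] := cU x y _ ltr01.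
  exists ((ball x dl `*` ball y dl), [set M | `|U x y| + 1 < M]) => /=.
    split; last by apply: nbhs_pinfty_gt; rewrite num_real.
    by exists (ball x dl, ball y dl) => //=; split; exact: nbhsx_ballx.
  move=> [[x' y'] M] [/= [hx hy] hM]; rewrite /ball/= distrC in hy.
  rewrite /ball/= distrC in hx.
  have A := H _ _ hx hy.
  have -> : U x' y' = (U x' y' - U x y) + U x y by ring.
  by apply: le_trans (ler_normD _ _) _; lra.
move=> M0 /= [_ H]; exists (M0 + 1) => x y hx hy.
have M1 : M0 < M0 + 1 by rewrite ltrDl.
by have := H _ M1 (x, y); apply; split; rewrite /= in_itv.
Qed.

End CompactUniformity.

(** * Means over circles around the origin *)

Section CircleMeans.
Context {R : realType}.
Implicit Types (z w : R[i]) (f : R[i] -> R[i]).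

Definition polar (x y : R) : R[i] := cexp (x +i* y)%C.

Lemma normc_polar x y : normc (polar x y) = expR x.
Proof. by rewrite normc_cexp. Qed.

Lemma polar_periodic x : polar x (pi *+ 2) = polar x 0.
Proof.
have -> : polar x (pi *+ 2) = polar x 0 * cexp (0 +i* (pi *+ 2))%C.
  rewrite /polar -cexpD; congr cexp.
  by apply: complex_eq; rewrite ?(ReD, ImD)/=; ring.
by rewrite cexp_2ipi mulr1.
Qed.

Lemma ccont_comp f g z : ccont f z -> ccont g (f z) -> ccont (g \o f) z.
Proof.
move=> cf cg e e0; have [d d0 H] := cg _ e0; have [d' d'0 H'] := cf _ d0.
by exists d' => // w /H'/H.
Qed.

Lemma cdiff_comp f g z : cdiff f z -> cdiff g (f z) -> cdiff (g \o f) z.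
Proof.
move=> /cdiffP df /cdiffP dg; apply/cdiffP.
exact: (@differentiable_comp _ R[i]^o R[i]^o R[i]^o f g z df dg).
Qed.

Lemma ccont_ReIm f x y : ccont f (x +i* y)%C ->
  joint_cont (fun x y => complex.Re (f (x +i* y)%C)) x y /\
  joint_cont (fun x y => complex.Im (f (x +i* y)%C)) x y /\
  joint_cont (fun x y => normc (f (x +i* y)%C)) x y.
Proof.
move=> cf; split; [|split]; move=> e e0;
  (have [d d0 H] := cf _ e0; exists (d / 2); first by rewrite divr_gt0);
  move=> x' y' hx hy;
  (have h : normc ((x' +i* y')%C - (x +i* y)%C) < d
    by apply: le_lt_trans (normc_le_ReIm _) _; rewrite ReB ImB/=; lra).
- by rewrite -ReB; apply: le_lt_trans (normc_Re _) (H _ h).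
- by rewrite -ImB; apply: le_lt_trans (normc_Im _) (H _ h).
- apply: le_lt_trans (H _ h); rewrite ler_norml normcB_ge andbT.
  by rewrite lerNl opprB normc_distC normcB_ge.
Qed.

Lemma joint_cont_1 (U : R -> R -> R) x y :
  joint_cont U x y -> {for x, continuous (U ^~ y)} /\ {for y, continuous (U x)}.
Proof.
move=> cU; split; apply/cvgrPdist_lt => e e0; have [d d0 H] := cU _ e0.
  exists d => //= x' hx; rewrite distrC; apply: H; first by rewrite distrC.
  by rewrite subrr normr0.
exists d => //= y' hy; rewrite distrC; apply: H; last by rewrite distrC.
by rewrite subrr normr0.
Qed.

(** The Cauchy-Riemann equations: multiplication by l acts on the plane by the
    matrix with rows (Re l, - Im l) and (Im l, Re l). *)
Lemma cdiff_real_diff2 f x y : cdiff f (x +i* y)%C -> exists l : R[i],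
  real_diff2 (fun x y => complex.Re (f (x +i* y)%C)) x y
    (complex.Re l) (- complex.Im l) /\
  real_diff2 (fun x y => complex.Im (f (x +i* y)%C)) x y
    (complex.Im l) (complex.Re l).
Proof.
move=> [l H]; exists l; split=> e e0;
  (have [d d0 Hd] := H _ e0; exists (d / 2); first by rewrite divr_gt0);
  move=> x' y' hx hy;
  set w := (x' +i* y')%C - (x +i* y)%C;
  (have nw : normc w <= `|x' - x| + `|y' - y|
     by apply: le_trans (normc_le_ReIm _) _; rewrite ReB ImB/=);
  (have {}Hd : normc (f (x' +i* y')%C - f (x +i* y)%C - l * w)
      <= e * (`|x' - x| + `|y' - y|)
    by apply: le_trans (Hd _ _) _; [lra|rewrite ler_pM2l]);
  apply: le_trans Hd.
- apply: le_trans (normc_Re _); rewrite !(ReB, ReM, ImB)/= le_eqVlt.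
  by apply/orP; left; apply/eqP; congr `|_|; ring.
- apply: le_trans (normc_Im _); rewrite !(ReB, ImM, ImB)/= le_eqVlt.
  by apply/orP; left; apply/eqP; congr `|_|; ring.
Qed.

Definition tends_at0 f l := forall e : R, 0 < e ->
  exists2 d : R, 0 < d & forall z, z != 0 -> normc z < d -> normc (f z - l) < e.

(** In the coordinate x + i y = log z, circles become vertical segments of
    length 2 pi. By [goursat], two such segments carry the same mean if the
    modulus [rho] does not lie between them: the horizontal sides cancel by
    periodicity. It is continuous across [rho], and
    tends to the real part of [l] when x tends to -oo. *)
Lemma circle_mean f rho l : 0 < rho ->
  (forall z, z != 0 -> ccont f z) ->
  (forall z, z != 0 -> normc z != rho -> cdiff f z) ->
  tends_at0 f l ->
  forall x, segint (fun y => complex.Re (f (polar x y))) 0 (pi *+ 2)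
    = complex.Re l * (pi *+ 2).
Proof.
move=> rho0 cf df fl.
have pi2 : (0 : R) <= pi *+ 2 by rewrite mulrn_wge0// pi_ge0.
pose F w := f (cexp w).
have cF w : ccont F w.
  apply: (ccont_comp (@cexp R) f); last exact: cf (cexp_neq0 _).
  exact/cdiff_cont/cdiff_cexp.
have dF w : expR (complex.Re w) != rho -> cdiff F w.
  move=> hw; apply: (cdiff_comp (@cexp R) f); first exact: cdiff_cexp.
  by apply: df; rewrite ?cexp_neq0 ?normc_cexp.
pose u x y := complex.Re (F (x +i* y)%C).
pose v x y := complex.Im (F (x +i* y)%C).
have ju x y : joint_cont u x y by have [] := ccont_ReIm F x y (cF _).
have jv x y : joint_cont v x y by have [_ []] := ccont_ReIm F x y (cF _).
pose J x := segint (u x) 0 (pi *+ 2).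
suff JE : forall x, J x = complex.Re l * (pi *+ 2) by exact: JE.
have cu y : continuous (u y) by move=> t; have [] := joint_cont_1 _ _ _ (ju y t).
have Jflat x1 x2 : x1 <= x2 -> (forall x, x1 <= x <= x2 -> expR x != rho) ->
    J x1 = J x2.
  move=> x12 hx.
  have : edge_circulation v u x1 x2 0 (pi *+ 2) = 0.
    apply: goursat => //.
  - by move=> y x; have [] := joint_cont_1 _ _ _ (jv x y).
  - move=> x y /hx xr _; have [m [m1 m2]] := cdiff_real_diff2 F x y (dF (x +i* y)%C xr).
    by exists (complex.Im m), (complex.Re m), (- complex.Im m).
  rewrite /edge_circulation.
  have -> : (fun x => v x 0 - v x (pi *+ 2)) = (fun=> 0).
    by apply/funext => x; rewrite /v /F -!/(polar _ _) polar_periodic subrr.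
  rewrite (@segint_cst _ 0 _ _ x12) mul0r add0r (segintB _ _ _ _ (cu x2) (cu x1)).
  by move=> /eqP; rewrite subr_eq0 => /eqP J21; exact: esym J21.
have Jlow x e : expR x < rho -> 0 < e -> `|J x - complex.Re l * (pi *+ 2)| <= e * (pi *+ 2).
  move=> xr e0; have [d d0 H] := fl _ e0.
  (* A smaller circle on which f is e-close to its limit. *)
pose x' := Num.min x (ln (d / 2)).
  have x'x : x' <= x by rewrite ge_min lexx.
  have x'd : expR x' < d.
    apply: le_lt_trans (_ : d / 2 < d); last by lra.
    by rewrite -[leRHS]lnK ?posrE ?divr_gt0// ler_expR ge_min lexx orbT.
  rewrite -(Jflat _ _ x'x); last first.
    by move=> t /andP[_ tx]; rewrite lt_eqF// (le_lt_trans _ xr)// ler_expR.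
  rewrite /J -[X in _ * X]subr0 -segint_cst// -segintB//; last exact: continuous_cst.
  rewrite -[X in _ * X]subr0; apply: segint_bound => //.
    by apply: continuous_sub => //; exact: continuous_cst.
  move=> y _; rewrite /u -ReB; apply: le_trans (normc_Re _) _.
  by apply/ltW/H; rewrite ?cexp_neq0 ?normc_cexp.
have Jcont x e : 0 < e -> exists2 dl, 0 < dl & forall x', `|x' - x| < dl ->
    `|J x' - J x| <= e * (pi *+ 2).
  move=> e0; have [dl dl0 H] := joint_cont_uniform u x 0 (pi *+ 2) (ju x) _ e0.
  exists dl => // x' hx; rewrite /J -segintB// -[X in _ * X]subr0.
  apply: segint_bound => //; first exact: continuous_sub.
  by move=> y hy; exact/ltW/H.
clearbody J.
pose x0 := ln rho; have ex0 : expR x0 = rho by rewrite lnK.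
have Jx0 e : 0 < e -> `|J x0 - complex.Re l * (pi *+ 2)| <= e * (pi *+ 2).
  move=> e0; have e20 : 0 < e / 2 by lra.
  have [dl dl0 H] := Jcont x0 _ e20; have := H (x0 - dl / 2).
  rewrite addrAC subrr add0r normrN gtr0_norm ?divr_gt0// => /(_ _) A.
  have {}A : `|J (x0 - dl / 2) - J x0| <= e / 2 * (pi *+ 2) by apply: A; lra.
  have B : `|J (x0 - dl / 2) - complex.Re l * (pi *+ 2)| <= e / 2 * (pi *+ 2).
    by apply: Jlow => //; rewrite -ex0 ltr_expR; lra.
  have -> : J x0 - complex.Re l * (pi *+ 2) =
    (J (x0 - dl / 2) - complex.Re l * (pi *+ 2)) - (J (x0 - dl / 2) - J x0) by ring.
  have -> : e * (pi *+ 2) = e / 2 * (pi *+ 2) + e / 2 * (pi *+ 2) by field.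
  by apply: le_trans (ler_normB _ _) _; exact: lerD.
have Jall x e : 0 < e -> `|J x - complex.Re l * (pi *+ 2)| <= e * (pi *+ 2).
  move=> e0; have [xx0|x0x] := ltP x x0; first by apply: Jlow; rewrite // -ex0 ltr_expR.
  have e20 : 0 < e / 2 by lra.
  move: x0x; rewrite le_eqVlt => /predU1P[<-|x0x]; first exact: Jx0.
  have [dl dl0 H] := Jcont x0 _ e20.
  pose x1 := Num.min x (x0 + dl / 2).
  have x1x : x1 <= x by rewrite ge_min lexx.
  have x01 : x0 < x1 by rewrite lt_min x0x; lra.
  have x1d : `|x1 - x0| < dl.
    rewrite gtr0_norm ?subr_gt0//.
    have : x1 <= x0 + dl / 2 by rewrite ge_min lexx orbT.
    by lra.
  rewrite -(Jflat _ _ x1x); last first.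
    move=> t /andP[tx _]; rewrite gt_eqF// -ex0 ltr_expR; exact: lt_le_trans tx.
  have -> : J x1 - complex.Re l * (pi *+ 2) =
    (J x0 - complex.Re l * (pi *+ 2)) + (J x1 - J x0) by ring.
  have -> : e * (pi *+ 2) = e / 2 * (pi *+ 2) + e / 2 * (pi *+ 2) by field.
  by apply: le_trans (ler_normD _ _) _; apply: lerD; [exact: Jx0|exact: H].
move=> x; apply/eqP; rewrite -subr_eq0 -normr_eq0; apply/eqP/le_anti.
rewrite normr_ge0 andbT; apply/ler_addgt0Pl => e e0; rewrite addr0.
have pi20 : (0 : R) < pi *+ 2 by rewrite pmulrn_lgt0// pi_gt0.
by have := Jall x _ (divr_gt0 e0 pi20); rewrite divfK// gt_eqF.
Qed.

End CircleMeans.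

(** * Schwarz lemma and Liouville theorem on the punctured plane *)

Section PuncturedPlane.
Context {R : realType}.
Implicit Types (z w : R[i]) (f g : R[i] -> R[i]).

Lemma cdiff_cst (k : R[i]) z : cdiff (fun=> k) z.
Proof. by apply/cdiffP; exact: differentiable_cst. Qed.

Lemma cdiff_id z : cdiff id z.
Proof.
exists 1 => e e0; exists 1 => // w _.
by rewrite mul1r subrr normc0 mulr_ge0 ?normc_ge0// ltW.
Qed.

Lemma cdiffD f g z : cdiff f z -> cdiff g z -> cdiff (fun w => f w + g w) z.
Proof. by move=> /cdiffP df /cdiffP dg; apply/cdiffP; exact: differentiableD. Qed.

Lemma cdiffN f z : cdiff f z -> cdiff (fun w => - f w) z.
Proof. by move=> /cdiffP df; apply/cdiffP; exact: differentiableN. Qed.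

Lemma cdiffB f g z : cdiff f z -> cdiff g z -> cdiff (fun w => f w - g w) z.
Proof. by move=> df dg; apply: cdiffD => //; exact: cdiffN. Qed.

Lemma cdiffM f g z : cdiff f z -> cdiff g z -> cdiff (fun w => f w * g w) z.
Proof.
move=> /cdiffP df /cdiffP dg; apply/cdiffP.
exact: (@differentiableM R[i] R[i]^o f g z df dg).
Qed.

Lemma cdiffV f z : cdiff f z -> f z != 0 -> cdiff (fun w => (f w)^-1) z.
Proof.
move=> /cdiffP df fz; apply/cdiffP.
exact: (@differentiableV R[i] R[i]^o f z df fz).
Qed.

Lemma cdiff_near f g z d : 0 < d ->
  (forall w, normc (w - z) < d -> f w = g w) -> cdiff g z -> cdiff f z.
Proof.
move=> d0 fg [l H]; exists l => e e0; have [d' d'0 H'] := H _ e0.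
exists (Num.min d d'); first by rewrite lt_min d0.
move=> w; rewrite lt_min => /andP[w1 w2].
by rewrite !fg// ?subrr ?normc0//; exact: H'.
Qed.

Lemma bounded_annulus f r s : 0 < r -> (forall z, z != 0 -> ccont f z) ->
  exists2 M, 0 < M & forall z, r <= normc z <= s -> normc (f z) <= M.
Proof.
move=> r0 cf; pose F w := f (cexp w).
have cF w : ccont F w.
  apply: (ccont_comp (@cexp R) f); last exact: cf (cexp_neq0 _).
  exact/cdiff_cont/cdiff_cexp.
have jF x y : joint_cont (fun x y => normc (F (x +i* y)%C)) x y.
  by have [_ []] := ccont_ReIm F x y (cF _).
have [M HM] := joint_cont_bounded _ (ln r) (ln s) (- pi) pi jF.
exists (Num.max M 1); first by rewrite lt_max ltr01 orbT.
move=> z /andP[rz zs]; have z0 : z != 0 by rewrite -normc_gt0 (lt_le_trans r0).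
have nz : 0 < normc z by rewrite normc_gt0.
have s0 : 0 < s by exact: lt_le_trans nz zs.
have [[x y] [ez /= ex yp]] := cexp_surj z z0.
rewrite le_max; apply/orP; left.
have := HM x y; rewrite ger0_norm ?normc_ge0// /F ez; apply.
  by rewrite ex !ler_ln ?posrE// rz.
by move: yp; rewrite ler_norml.
Qed.

(** The hypotheses of [circle_mean]. *)
Definition mean_regular f rho l := [/\ 0 < rho,
  forall z, z != 0 -> ccont f z,
  forall z, z != 0 -> normc z != rho -> cdiff f z & tends_at0 f l].

Lemma mean_regularZ (k : R[i]) f rho l : normc k = 1 -> mean_regular f rho l ->
  mean_regular (fun z => k * f z) rho (k * l).
Proof.
move=> k1 [rho0 cf df fl]; split => //.
- move=> z z0 e e0; have [d d0 H] := cf z z0 _ e0; exists d => // w /H.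
  by rewrite -mulrBr normcM k1 mul1r.
- by move=> z z0 zr; apply: cdiffM; [exact: cdiff_cst|exact: df].
- move=> e e0; have [d d0 H] := fl _ e0; exists d => // z z0 /(H z z0).
  by rewrite -mulrBr normcM k1 mul1r.
Qed.

(** Each limit at 0 is a mean over |z| = r. Real and imaginary parts are
    treated separately, whence the factor 2. *)
Lemma mean_regular_limit_le f0 f1 rho0 rho1 l0 l1 r B : 0 < r ->
  mean_regular f0 rho0 l0 -> mean_regular f1 rho1 l1 ->
  (forall z, normc z = r -> normc (f0 z - f1 z) <= B) ->
  normc (l0 - l1) <= 2 * B.
Proof.
move=> r0; have pi20 : (0 : R) < pi *+ 2 by rewrite pmulrn_lgt0// pi_gt0.
have key g0 g1 m0 m1 : mean_regular g0 rho0 m0 -> mean_regular g1 rho1 m1 ->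
    (forall z, normc z = r -> normc (g0 z - g1 z) <= B) ->
    `|complex.Re (m0 - m1)| <= B.
  move=> [rho00 c0 d0 t0] [rho10 c1 d1 t1] H.
  have cont g : (forall z, z != 0 -> ccont g z) ->
      continuous (fun y => complex.Re (g (polar (ln r) y))).
    move=> cg y; pose F w := g (cexp w).
    have cF w : ccont F w.
      apply: (ccont_comp (@cexp R) g); last exact: cg (cexp_neq0 _).
      exact/cdiff_cont/cdiff_cexp.
    have [jF _] := ccont_ReIm F (ln r) y (cF _).
    by have [] := joint_cont_1 _ _ _ jF.
  have h0 := circle_mean g0 rho0 m0 rho00 c0 d0 t0 (ln r).
  have h1 := circle_mean g1 rho1 m1 rho10 c1 d1 t1 (ln r).
  have := segintB _ _ 0 (pi *+ 2) (cont _ c0) (cont _ c1).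
  rewrite h0 h1 -mulrBl -ReB => hI.
  rewrite -(ler_pM2r pi20) -{1}(ger0_norm (ltW pi20)) -normrM -hI.
  rewrite -[X in _ <= _ * X]subr0; apply: segint_bound; last 2 first.
  - exact: ltW.
  - move=> y _; rewrite -ReB; apply: le_trans (normc_Re _) _.
    by apply: H; rewrite normc_polar lnK.
  by apply: continuous_sub; exact: cont.
move=> m0 m1 H; have A := key _ _ _ _ m0 m1 H.
have ni : normc (- 'i%C) = 1 :> R.
  by rewrite normc_opp /normc expr0n expr1n add0r sqrtr1.
have := key _ _ _ _ (mean_regularZ _ _ _ _ ni m0) (mean_regularZ _ _ _ _ ni m1).
move=> /(_ _) B'; have {}B' : `|complex.Re (- 'i%C * l0 - - 'i%C * l1)| <= B.
  apply: B' => z /H; rewrite -mulrBr normcM ni mul1r; exact.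
have C : complex.Re (- 'i%C * l0 - - 'i%C * l1) = complex.Im (l0 - l1).
  by rewrite -mulrBr; case: (l0 - l1) => x y /=; ring.
by apply: le_trans (normc_le_ReIm _) _; rewrite C in B'; lra.
Qed.

(** The value [d] at [z0] is meant to be the derivative of f there. *)
Definition diff_quotient f z0 (d z : R[i]) :=
  if z == z0 then d else (f z - f z0) / (z - z0).

Lemma tends_at0_diff_quotient f z0 d : z0 != 0 -> tends_at0 f 0 ->
  tends_at0 (diff_quotient f z0 d) (f z0 / z0).
Proof.
move=> z00 f0 e e0; have n0 : 0 < normc z0 by rewrite normc_gt0.
set n := normc z0 in n0.
have [d1 d10 H1] := f0 _ (divr_gt0 (mulr_gt0 e0 n0) (ltr0n R 4)).
pose m := normc (f z0) + 1.
have m0 : 0 < m by rewrite ltr_wpDl ?normc_ge0.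
(* Both terms of z0 f z - f z0 z are made at most a fourth of e |z0|^2. *)
pose d2 := e * n ^+ 2 / (4 * m).
have d20 : 0 < d2 by rewrite divr_gt0 ?mulr_gt0 ?exprn_gt0.
exists (Num.min (n / 2) (Num.min d1 d2)).
  by rewrite lt_min divr_gt0//= lt_min d10.
move=> z zn0; rewrite !lt_min => /and3P[zn z1 z2].
have zz0 : z != z0 by apply: contraTneq zn => ->; rewrite -leNgt -/n; lra.
rewrite /diff_quotient (negbTE zz0).
have zz1 : z - z0 != 0 by rewrite subr_eq0.
have -> : (f z - f z0) / (z - z0) - f z0 / z0 =
    (z0 * f z - f z0 * z) / (z0 * (z - z0)).
  by field; rewrite z00 zz1.
rewrite normcM normcV normcM ltr_pdivrMr; last by rewrite mulr_gt0 ?normc_gt0.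
have dz : n / 2 < normc (z - z0).
  by have := normcB_ge z0 z; rewrite normc_distC -/n; lra.
apply: lt_le_trans (_ : e * (n * (n / 2)) <= _); last by rewrite !ler_pM2l// ltW.
apply: le_lt_trans (normcB _ _) _; rewrite !normcM -/n.
have A : n * normc (f z) < n * (e * n / 4).
  by rewrite ltr_pM2l//; have := H1 z zn0 z1; rewrite subr0.
have B : normc (f z0) * normc z <= e * n ^+ 2 / 4.
  apply: le_trans (_ : m * d2 <= _).
    by rewrite ler_pM ?normc_ge0// ?(ltW z2)// lerDl.
  by rewrite /d2 le_eqVlt; apply/orP; left; apply/eqP; field; rewrite gt_eqF.
by apply: lt_le_trans (ltr_leD A B) _; rewrite le_eqVlt; apply/orP; left; apply/eqP; field.
Qed.

(** The difference quotient is continuous at [z0] and holomorphic elsewhere: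
    it is for its sake that [circle_mean] allows an exceptional modulus. *)
Lemma diff_quotient_regular f z0 : (forall z, z != 0 -> cdiff f z) ->
  tends_at0 f 0 -> z0 != 0 ->
  exists d, mean_regular (diff_quotient f z0 d) (normc z0) (f z0 / z0).
Proof.
move=> df f0 z00; have [d Hd] := df _ z00; exists d.
have dq z : z != 0 -> z != z0 -> cdiff (diff_quotient f z0 d) z.
  move=> zn0 zz0; have zz : 0 < normc (z - z0) by rewrite normc_gt0 subr_eq0.
  apply: (@cdiff_near _ (fun w => (f w - f z0) * (w - z0)^-1) _ _ zz).
    move=> w wz; rewrite /diff_quotient ifN//.
    by apply: contraTneq wz => ->; rewrite -leNgt normc_distC.
  apply: cdiffM.
    by apply: cdiffB; [exact: df|exact: cdiff_cst].
  apply: cdiffV; last by rewrite subr_eq0.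
  by apply: cdiffB; [exact: cdiff_id|exact: cdiff_cst].
split.
- by rewrite normc_gt0.
- move=> z zn0; have [->|zz0] := eqVneq z z0; last exact/cdiff_cont/dq.
  move=> e e0; have e20 : 0 < e / 2 by lra.
  have [d' d'0 H] := Hd _ e20; exists d' => // w /H.
  rewrite /diff_quotient eqxx; have [_ _|wz0] := eqVneq w z0.
    by rewrite subrr normc0.
  have w0 : w - z0 != 0 by rewrite subr_eq0.
  have nw : 0 < normc (w - z0) by rewrite normc_gt0.
  move=> h; apply: le_lt_trans (_ : e / 2 < e); last by lra.
  rewrite -(ler_pM2r nw); apply: le_trans h; rewrite -normcM le_eqVlt.
  by apply/orP; left; apply/eqP; congr normc; field.
- move=> z zn0 zz0; apply: dq => //; by apply: contraNneq zz0 => ->.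
- exact: tends_at0_diff_quotient.
Qed.

(** The limit at 0 of the difference quotient of f at z is f z / z; so it is a
    mean of this quotient over |w| = 1, where the quotient is bounded
    uniformly in small z. *)
Lemma schwarz_at0 f : (forall z, z != 0 -> cdiff f z) -> tends_at0 f 0 ->
  exists C d, [/\ 0 < C, 0 < d &
    forall z, z != 0 -> normc z < d -> normc (f z) <= C * normc z].
Proof.
move=> df f0.
have cf w : w != 0 -> ccont f w by move=> w0; exact: cdiff_cont (df w w0).
have [M M0 HM] := bounded_annulus f 1 1 ltr01 cf.
have [d1 d10 Hd1] := f0 _ ltr01.
exists (4 * (M + 1)), (Num.min d1 (1 / 2)).
split; [by rewrite mulr_gt0 ?addr_gt0|by rewrite lt_min d10 divr_gt0|].
move=> z zn0; rewrite lt_min => /andP[z1 z2].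
have nz : 0 < normc z by rewrite normc_gt0.
have [d Hd] := diff_quotient_regular f z df f0 zn0.
(* The zero function serves as the second function in [mean_regular_limit_le]. *)
have H0 : mean_regular (fun=> 0) 1 0.
  split => //; first by move=> w _; exact/cdiff_cont/cdiff_cst.
    by move=> w _ _; exact: cdiff_cst.
  by move=> e e0; exists 1 => // w _ _; rewrite subrr normc0.
have := @mean_regular_limit_le _ _ _ _ _ _ 1 (2 * (M + 1)) ltr01 Hd H0.
rewrite subr0 normcM normcV ler_pdivrMr// => H.
have -> : 4 * (M + 1) = 2 * (2 * (M + 1)) by ring.
apply: H => w w1; rewrite subr0 /diff_quotient ifN; last first.
  by apply: contraTneq z2 => <-; rewrite w1 -leNgt; lra.
have wz : 1 / 2 <= normc (w - z) by have := normcB_ge w z; rewrite w1; lra.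
rewrite normcM normcV ler_pdivrMr; last by apply: lt_le_trans wz; lra.
apply: le_trans (_ : M + 1 <= _).
  apply: le_trans (normcB _ _) _; apply: lerD; first by apply: HM; rewrite w1 lexx.
  by have := Hd1 z zn0 z1; rewrite subr0 => /ltW.
apply: le_trans (_ : 2 * (M + 1) * (1 / 2) <= _); first by lra.
by rewrite ler_pM2l ?mulr_gt0 ?addr_gt0.
Qed.

(** With g z = z f z, the difference quotients of g at z0 and z1 have limits
    f z0 and f z1 at 0, and they differ by O (1 / r) on the circle |z| = r. *)
Lemma liouville_punctured f B : (forall z, z != 0 -> cdiff f z) ->
  (forall z, z != 0 -> normc (f z) <= B) ->
  forall z0 z1, z0 != 0 -> z1 != 0 -> f z0 = f z1.
Proof.
move=> df fB z0 z1 z00 z10.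
have B0 : 0 <= B := le_trans (normc_ge0 _) (fB _ z00).
pose g z := z * f z.
have dg z : z != 0 -> cdiff g z by move=> zn0; apply: cdiffM; [exact: cdiff_id|exact: df].
have g0 : tends_at0 g 0.
  move=> e e0; have B1 : 0 < B + 1 by rewrite ltr_wpDl.
  exists (e / (B + 1)); first by rewrite divr_gt0.
  move=> z zn0; rewrite ltr_pdivlMr// subr0 normcM => h.
  apply: le_lt_trans h; rewrite ler_wpM2l ?normc_ge0//.
  by apply: le_trans (fB _ zn0) _; rewrite lerDl.
have [d0 H0] := diff_quotient_regular g z0 dg g0 z00.
have [d1 H1] := diff_quotient_regular g z1 dg g0 z10.
have gE z : z != 0 -> g z / z = f z by move=> zn0; rewrite /g mulrC mulKf.
rewrite gE// in H0; rewrite gE// in H1.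
pose S := normc z0 + normc z1.
have S0 : 0 < S by rewrite addr_gt0 ?normc_gt0.
have key r : 2 * S < r -> normc (f z0 - f z1) <= 2 * (6 * B * S / r).
  move=> Sr; have r0 : 0 < r by lra.
  apply: (mean_regular_limit_le _ _ _ _ _ _ r _ r0 H0 H1) => z zr.
  have n0 := normc_ge0 z0; have n1 := normc_ge0 z1.
  have zz0 : z != z0 by apply: contraTneq Sr => h; rewrite -zr h -leNgt /S; lra.
  have zz1 : z != z1 by apply: contraTneq Sr => h; rewrite -zr h -leNgt /S; lra.
  rewrite /diff_quotient (negbTE zz0) (negbTE zz1).
  have zn0 : z != 0 by rewrite -normc_gt0 zr.
  pose p := (z - z0)^-1; pose q := (z - z1)^-1.
  have inv w : w != z -> normc w <= S -> normc (z - w)^-1 <= 2 / r.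
    move=> wz wS; rewrite normcV -[2 / r]invf_div lef_pV2 ?posrE ?divr_gt0//.
      by have := normcB_ge z w; rewrite zr; lra.
    by rewrite normc_gt0 subr_eq0 eq_sym.
  have pr : normc p <= 2 / r by apply: inv; rewrite 1?eq_sym// /S; lra.
  have qr : normc q <= 2 / r by apply: inv; rewrite 1?eq_sym// /S; lra.
  have -> : (g z - g z0) / (z - z0) - (g z - g z1) / (z - z1) =
      z * f z * ((z0 - z1) * (p * q)) - z0 * f z0 * p + z1 * f z1 * q.
    by rewrite /g /p /q; field; rewrite !subr_eq0 zz0 zz1.
  have T1 : normc (z * f z * ((z0 - z1) * (p * q))) <= r * B * (S * (2 / r * (2 / r))).
    rewrite !normcM zr; apply: ler_pM; rewrite ?mulr_ge0 ?normc_ge0 ?(ltW r0)//.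
      by rewrite ler_pM2l//; exact: fB.
    apply: ler_pM; rewrite ?mulr_ge0 ?normc_ge0//; first exact: normcB.
    by apply: ler_pM; rewrite ?normc_ge0.
  have T2 : normc (z0 * f z0 * p) <= normc z0 * B * (2 / r).
    rewrite !normcM; apply: ler_pM; rewrite ?mulr_ge0 ?normc_ge0//.
    by rewrite ler_wpM2l//; exact: fB.
  have T3 : normc (z1 * f z1 * q) <= normc z1 * B * (2 / r).
    rewrite !normcM; apply: ler_pM; rewrite ?mulr_ge0 ?normc_ge0//.
    by rewrite ler_wpM2l//; exact: fB.
  apply: le_trans (normcD _ _) _; apply: le_trans (lerD (normcB _ _) (lexx _)) _.
  apply: le_trans (lerD (lerD T1 T2) T3) _.
  rewrite le_eqVlt; apply/orP; left; apply/eqP; rewrite /S; field.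
  by rewrite gt_eqF.
apply/eqP; rewrite -subr_eq0 -normc_eq0; apply: contraTT isT => Dn0.
set D := normc _ in Dn0 key.
have D0 : 0 < D by rewrite lt_def Dn0 normc_ge0.
(* Chosen so that 12 B S / r < D and 2 S < r. *)
pose r := 2 * S + 12 * B * S / D + 1.
have X0 : 0 <= 12 * B * S / D by rewrite divr_ge0 ?mulr_ge0// ltW.
have Sr : 2 * S < r by rewrite /r; lra.
have r0 : 0 < r by lra.
have := key _ Sr; rewrite mulrA ler_pdivlMr//.
have -> : D * r = 2 * S * D + 12 * B * S + D by rewrite /r; field; rewrite gt_eqF.
have : 0 <= S * D by rewrite mulr_ge0// ltW.
by move=> h1 h2; exfalso; lra.
Qed.

End PuncturedPlane.

(** * Automorphisms of the punctured plane with a logarithm *)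

Section PuncturedPlaneAutomorphism.
Context {R : realType}.
Implicit Types (z w : R[i]) (f g h k : R[i] -> R[i]).

(** For h holomorphic, these are the holomorphic self-maps of the punctured
    plane with winding number 1 around 0. *)
Definition twist h z := z * cexp (h z).

Definition twist_inverse h k := [/\ forall z, z != 0 -> cdiff h z,
  forall z, z != 0 -> cdiff k z,
  forall z, z != 0 -> twist k (twist h z) = z &
  forall z, z != 0 -> twist h (twist k z) = z].

Lemma twist_inverse_sym h k : twist_inverse h k -> twist_inverse k h.
Proof. by case. Qed.

Lemma normc_twist h z : normc (twist h z) = normc z * expR (complex.Re (h z)).
Proof. by rewrite normcM normc_cexp. Qed.

Lemma twist_neq0 h z : z != 0 -> twist h z != 0.
Proof. by move=> z0; rewrite mulf_neq0 ?cexp_neq0. Qed.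

Lemma cdiff_cexp_comp h z : cdiff h z -> cdiff (fun w => cexp (h w)) z.
Proof. by move=> dh; apply: (cdiff_comp h (@cexp R)) => //; exact: cdiff_cexp. Qed.

Lemma cdiff_twist h z : cdiff h z -> cdiff (twist h) z.
Proof.
by move=> dh; apply: cdiffM; [exact: cdiff_id|exact: cdiff_cexp_comp].
Qed.

Lemma cdiff_inv z : z != 0 -> cdiff (fun w => w^-1) z.
Proof. by move=> z0; apply: (cdiffV id) => //; exact: cdiff_id. Qed.

(** Inversion z |-> 1 / z conjugates [twist h] to [twist (at_infinity h)]. *)
Definition at_infinity h z := - h z^-1.

Lemma twist_at_infinity h z : twist (at_infinity h) z = (twist h z^-1)^-1.
Proof.
by rewrite /twist /at_infinity cexpN [in RHS]invfM invrK.
Qed.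

Lemma twist_inverse_at_infinity h k : twist_inverse h k ->
  twist_inverse (at_infinity h) (at_infinity k).
Proof.
move=> [dh dk kh hk]; split=> z z0.
- apply: cdiffN; apply: (cdiff_comp (fun w => w^-1) h); first exact: cdiff_inv.
  by apply: dh; rewrite invr_eq0.
- apply: cdiffN; apply: (cdiff_comp (fun w => w^-1) k); first exact: cdiff_inv.
  by apply: dk; rewrite invr_eq0.
- by rewrite !twist_at_infinity invrK kh ?invrK// invr_eq0.
- by rewrite !twist_at_infinity invrK hk ?invrK// invr_eq0.
Qed.

Lemma small_point (d : R) : 0 < d -> exists2 z : R[i], z != 0 & normc z < d.
Proof.
move=> d0; exists (d / 2)%:C%C.
  by rewrite -normc_gt0 normc_real gtr0_norm ?divr_gt0.
by rewrite normc_real gtr0_norm ?divr_gt0//; lra.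
Qed.

(** A point z sent into the annulus is z = twist k (twist h z), and k is
    bounded on the annulus: z cannot be close to 0. *)
Lemma twist_avoids_annulus h k r s : twist_inverse h k -> 0 < r ->
  exists2 d, 0 < d & forall z, z != 0 -> normc z < d ->
    ~ (r <= normc (twist h z) <= s).
Proof.
move=> [_ dk kh _] r0.
have [M M0 HM] := bounded_annulus k r s r0 (fun w nw => cdiff_cont k w (dk w nw)).
exists (r * expR (- M)); first by rewrite mulr_gt0 ?expR_gt0.
move=> z z0 zd fz; move: zd; rewrite -[in normc z](kh z z0) normc_twist ltNge.
move/negP; apply; apply: ler_pM; rewrite ?(ltW r0) ?expR_ge0//; first by case/andP: fz.
rewrite ler_expR lerNl; apply: le_trans (HM _ fz); apply: le_trans (normc_Re _).
by rewrite -normrN ler_norm.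
Qed.

(** Near 0 the unit circle is avoided, and a punctured disc is connected: in
    the coordinate log z it is a half-plane, so that segments stay in it. *)
Lemma twist_dichotomy h k : twist_inverse h k -> exists2 d, 0 < d &
  (forall z, z != 0 -> normc z < d -> normc (twist h z) < 1) \/
  (forall z, z != 0 -> normc z < d -> 1 < normc (twist h z)).
Proof.
move=> hk; have [d d0 Hd] := twist_avoids_annulus h k 1 1 hk ltr01.
exists d => //; have [//|/existsNP[z1]] := pselect
  (forall z, z != 0 -> normc z < d -> normc (twist h z) < 1); first by left.
move=> /not_implyP[z10] /not_implyP[z1d] /negP; rewrite -leNgt => fz1.
right=> z2 z20 z2d; rewrite ltNge; apply/negP => fz2.
have [w1 [e1 r1 _]] := cexp_surj z1 z10.
have [w2 [e2 r2 _]] := cexp_surj z2 z20.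
pose p (t : R) := w1 + t%:C%C * (w2 - w1).
pose U t := normc (twist h (cexp (p t))).
have cU : continuous U.
  move=> t; apply/cvgrPdist_lt => e e0.
  have cT : ccont (twist h \o @cexp R) (p t).
    apply: ccont_comp; first exact/cdiff_cont/cdiff_cexp.
    by apply/cdiff_cont/cdiff_twist; case: hk => + _ _ _; apply; exact: cexp_neq0.
  have [dl dl0 H] := cT _ e0.
  have n1 : 0 < normc (w2 - w1) + 1 by rewrite ltr_wpDl ?normc_ge0.
  exists (dl / (normc (w2 - w1) + 1)); first by rewrite /= divr_gt0.
  move=> t' /=; rewrite distrC ltr_pdivlMr// => tt'.
  have h1 : normc (p t' - p t) < dl.
    have -> : p t' - p t = (t' - t)%:C%C * (w2 - w1) by rewrite rmorphB /p; ring.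
    rewrite normcM normc_real; apply: le_lt_trans tt'.
    by rewrite ler_wpM2l// lerDl.
  rewrite distrC; apply: le_lt_trans (H _ h1); rewrite ler_norml normcB_ge andbT.
  by rewrite lerNl opprB normc_distC normcB_ge.
have [] := @IVT R U 0 1 1 ler01 (continuous_subspaceT cU).
  have p0 : p 0 = w1 by rewrite /p rmorph0 mul0r addr0.
  have p1 : p 1 = w2 by rewrite /p rmorph1 mul1r addrC subrK.
  by rewrite /U p0 p1 e1 e2 ge_min le_max fz1 fz2 orbT.
move=> t; rewrite in_itv/= => /andP[t0 t1] Ut.
apply: (Hd (cexp (p t))); rewrite ?cexp_neq0// -/(U t) ?Ut ?lexx//.
rewrite normc_cexp /p ReD ReM /= mul0r subr0 ReB r1 r2 -[X in _ < X]lnK// ltr_expR.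
have l1 : ln (normc z1) < ln d by rewrite ltr_ln ?posrE ?normc_gt0.
have l2 : ln (normc z2) < ln d by rewrite ltr_ln ?posrE ?normc_gt0.
have [l12|l21] := leP (ln (normc z1)) (ln (normc z2)).
  by have : t * (ln (normc z2) - ln (normc z1)) <= ln (normc z2) - ln (normc z1);
    [rewrite ler_piMl ?subr_ge0|lra].
by have : t * (ln (normc z2) - ln (normc z1)) <= 0;
  [rewrite mulr_ge0_le0// subr_le0 ltW|lra].
Qed.

Lemma twist_limit h k : twist_inverse h k ->
  tends_at0 (twist h) 0 \/ tends_at0 (fun z => (twist h z)^-1) 0.
Proof.
move=> hk; have [d d0 [H|H]] := twist_dichotomy h k hk; [left|right] => e e0.
  have [d' d'0 H'] := twist_avoids_annulus h k e 1 hk e0.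
  exists (Num.min d d'); first by rewrite lt_min d0.
  move=> z z0; rewrite lt_min => /andP[zd zd']; rewrite subr0 ltNge.
  by apply/negP => ez; apply: (H' z) => //; rewrite ez ltW// H.
have [d' d'0 H'] := twist_avoids_annulus h k 1 e^-1 hk ltr01.
exists (Num.min d d'); first by rewrite lt_min d0.
move=> z z0; rewrite lt_min => /andP[zd zd']; rewrite subr0 normcV ltNge.
have f1 := H z z0 zd; apply/negP => ez; apply: (H' z) => //; rewrite (ltW f1)/=.
by rewrite -[leLHS]invrK lef_pV2 ?posrE ?invr_gt0// (lt_trans _ f1).
Qed.

(** When z tends to 0 so does f z, and g (f z) = z would be large. *)
Lemma inverse_limit_absurd f g : (forall z, z != 0 -> f z != 0) ->
  (forall z, z != 0 -> g (f z) = z) ->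
  tends_at0 f 0 -> tends_at0 (fun z => (g z)^-1) 0 -> False.
Proof.
move=> f0 gf lf lg; have [d d0 H] := lg _ ltr01; have [d' d'0 H'] := lf _ d0.
have m0 : 0 < Num.min d' 1 by rewrite lt_min d'0 ltr01.
have [z z0] := small_point _ m0; rewrite lt_min => /andP[zd z1].
have := H (f z) (f0 z z0); have := H' z z0 zd; rewrite subr0 => A /(_ A).
rewrite subr0 gf// normcV invf_lt1 ?normc_gt0// => B.
by have := lt_trans B z1; rewrite ltxx.
Qed.

(** Otherwise twist h z tends to infinity, and exp (- h / 4), whose fourth
    power is z / twist h z, tends to 0. So it is O (z) by the Schwarz lemma,
    and 1 / twist h z = O (z^3). But G v = twist k (1 / v) also tends to 0 at
    0, so that z = G (1 / twist h z) = O (1 / twist h z). *)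
Lemma twist_tends_at0 h k : twist_inverse h k -> tends_at0 (twist h) 0.
Proof.
move=> hk; have [//|fV0] := twist_limit h k hk; exfalso.
have [dh dk kh _] := hk.
pose phi z := cexp (- h z / 4%:R).
have phi4 z : z != 0 -> normc (phi z) ^+ 4 = normc z * normc (twist h z)^-1.
  move=> z0; rewrite -normcX -cexpMn mulrC divfK ?pnatr_eq0// cexpN.
  rewrite !normcV normc_cexp normc_twist; field.
  by rewrite gt_eqF ?expR_gt0//= gt_eqF// normc_gt0.
have dphi z : z != 0 -> cdiff phi z.
  move=> z0; apply: cdiff_cexp_comp; apply: cdiffM; last exact: cdiff_cst.
  by apply: cdiffN; exact: dh.
have phi0 : tends_at0 phi 0.
  move=> e e0; have [d d0 H] := fV0 _ (exprn_gt0 4 e0).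
  exists (Num.min d 1); first by rewrite lt_min d0 ltr01.
  move=> z z0; rewrite lt_min => /andP[zd z1]; rewrite subr0.
  rewrite -(@ltr_pXn2r _ 4)// ?nnegrE ?normc_ge0 ?(ltW e0)// phi4//.
  have := H z z0 zd; rewrite subr0; apply: le_lt_trans.
  by rewrite ler_piMl ?normc_ge0 ?ltW.
have [C [d [C0 d0 HC]]] := schwarz_at0 phi dphi phi0.
pose G v := twist k v^-1.
have G0 : tends_at0 G 0.
  have := twist_inverse_at_infinity _ _ (twist_inverse_sym _ _ hk).
  move=> /twist_limit[] lim.
    exfalso; apply: (inverse_limit_absurd (fun z => (twist h z)^-1) G) => //.
    - by move=> z z0; rewrite invr_eq0 twist_neq0.
    - by move=> z z0; rewrite /G invrK kh.
    - by move=> e e0; have [d' d'0 H] := lim _ e0; exists d' => // z z0 /(H z z0);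
        rewrite twist_at_infinity.
  move=> e e0; have [d' d'0 H] := lim _ e0; exists d' => // z z0 /(H z z0).
  by rewrite twist_at_infinity invrK.
have dG z : z != 0 -> cdiff G z.
  move=> z0; apply: (cdiff_comp (fun w => w^-1) (twist k)); first exact: cdiff_inv.
  by apply/cdiff_twist/dk; rewrite invr_eq0.
have [C' [d' [C'0 d'0 HC']]] := schwarz_at0 G dG G0.
have [d2 d20 H2] := fV0 _ d'0.
(* The two estimates combine to |z| <= K |z|^3, absurd if |z| < 1 and K |z| < 1. *)
pose K := C' * C ^+ 4; have K0 : 0 < K by rewrite mulr_gt0 ?exprn_gt0.
have m0 : 0 < Num.min (Num.min d d2) (Num.min 1 K^-1).
  by rewrite !lt_min d0 d20 ltr01 invr_gt0.
have [z z0] := small_point _ m0; rewrite !lt_min => /andP[/andP[zd z2] /andP[z1 zK]].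
have nz : 0 < normc z by rewrite normc_gt0.
have fVn : (twist h z)^-1 != 0 by rewrite invr_eq0 twist_neq0.
have A : normc z <= C' * normc (twist h z)^-1.
  have := H2 z z0 z2; rewrite subr0 => /(HC' _ fVn).
  by rewrite /G invrK kh.
have B : normc z * normc (twist h z)^-1 <= (C * normc z) ^+ 4.
  by rewrite -phi4// ler_pXn2r// ?nnegrE ?mulr_ge0 ?normc_ge0 ?(ltW C0)// HC.
have D : normc z ^+ 2 <= K * normc z ^+ 4.
  rewrite expr2 /K -mulrA -exprMn; apply: le_trans (_ : C' * (normc z * normc (twist h z)^-1) <= _).
    by rewrite mulrCA ler_pM2l.
  by rewrite ler_pM2l.
have E : 1 <= K * normc z ^+ 2.
  have n2 : 0 < normc z ^+ 2 by rewrite exprn_gt0.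
  by rewrite -(ler_pM2r n2) mul1r -mulrA -exprD.
have F : K * normc z ^+ 2 < 1.
  rewrite expr2 mulrA; apply: lt_trans (_ : normc z < 1) => //.
  by rewrite gtr_pMl// mulrC -ltr_pdivlMr// mul1r.
by have := le_lt_trans E F; rewrite ltxx.
Qed.

(** By the Schwarz lemma both maps are O (z) at 0. For [twist h] this bounds
    Re h from above; for its inverse, at the point twist h z, from below. *)
Lemma twist_Re_bounded_at0 h k : twist_inverse h k -> exists B d, 0 < d /\
  forall z, z != 0 -> normc z < d -> `|complex.Re (h z)| <= B.
Proof.
move=> hk; have kh := twist_inverse_sym _ _ hk.
have f0 := twist_tends_at0 _ _ hk; have g0 := twist_tends_at0 _ _ kh.
have df z : z != 0 -> cdiff (twist h) z.
  by move=> z0; apply: cdiff_twist; case: hk => + _ _ _; exact.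
have dg z : z != 0 -> cdiff (twist k) z.
  by move=> z0; apply: cdiff_twist; case: hk => _ + _ _; exact.
have [C [d [C0 d0 HC]]] := schwarz_at0 _ df f0.
have [C' [d' [C'0 d'0 HC']]] := schwarz_at0 _ dg g0.
have [d2 d20 H2] := f0 _ d'0.
exists (`|ln C| + `|ln C'|), (Num.min d d2); split; first by rewrite lt_min d0.
move=> z z0; rewrite lt_min => /andP[zd z2].
have nz : 0 < normc z by rewrite normc_gt0.
have A := HC z z0 zd; rewrite normc_twist mulrC ler_pM2r// in A.
have := H2 z z0 z2; rewrite subr0 => /(HC' _ (twist_neq0 _ _ z0)).
case: hk => _ _ -> // _; rewrite normc_twist mulrCA ler_pMr// => B.
have {}A : complex.Re (h z) <= ln C by rewrite -ler_expR lnK.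
have {}B : - complex.Re (h z) <= ln C'.
  by rewrite -ler_expR lnK// expRN -[leLHS]mul1r ler_pdivrMr ?expR_gt0.
rewrite ler_norml; have := ler_norm (ln C); have := ler_norm (ln C').
by have := normr_ge0 (ln C); have := normr_ge0 (ln C'); lra.
Qed.

(** Re h is bounded near 0, by inversion near infinity, and by compactness in
    between. So exp (h / N) is constant for every N by [liouville_punctured];
    for N large, h z0 / N and h z1 / N are closer than the period of [cexp]. *)
Theorem twist_inverse_constant h k : twist_inverse h k ->
  forall z0 z1, z0 != 0 -> z1 != 0 -> h z0 = h z1.
Proof.
move=> hk z0 z1 z00 z10; have [dh _ _ _] := hk.
have [B HB] : exists B, forall z, z != 0 -> `|complex.Re (h z)| <= B.
  have [B0 [d0 [d00 H0]]] := twist_Re_bounded_at0 _ _ hk.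
  have [B1 [d1 [d10 H1]]] := twist_Re_bounded_at0 _ _ (twist_inverse_at_infinity _ _ hk).
  have [M _ HM] := bounded_annulus h d0 d1^-1 d00 (fun w nw => cdiff_cont h w (dh w nw)).
  exists (Num.max B0 (Num.max B1 M)) => z zn0; rewrite !le_max.
  have [zd0|d0z] := ltP (normc z) d0; first by rewrite H0.
  have [zd1|d1z] := leP (normc z) d1^-1.
    by rewrite (le_trans (normc_Re _) (HM _ _)) ?orbT// d0z.
  have := H1 z^-1; rewrite /at_infinity ReN normrN invrK => -> //.
  - by rewrite orbT.
  - by rewrite invr_eq0.
  - by rewrite normcV -[ltRHS]invrK ltf_pV2 ?posrE ?invr_gt0 ?normc_gt0.
pose N := Num.bound (normc (h z0 - h z1)).
have N0 : (0 < N)%N.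
  by have := archi_boundP (normc_ge0 (h z0 - h z1)); rewrite -/N; case: (N) => //; rewrite ltNge normc_ge0.
have Nr : (0 : R) < N%:R by rewrite ltr0n.
have Nn : (N%:R : R[i]) != 0 by rewrite pnatr_eq0 -lt0n.
pose phi z := cexp (h z / N%:R).
have dphi z : z != 0 -> cdiff phi z.
  move=> zn0; apply: cdiff_cexp_comp; apply: cdiffM; last exact: cdiff_cst.
  exact: dh.
have bphi z : z != 0 -> normc (phi z) <= expR B.
  move=> zn0; rewrite normc_cexp ler_expR.
  have -> : complex.Re (h z / N%:R) = complex.Re (h z) / N%:R.
    rewrite -(rmorph_nat (real_complex R)) -fmorphV ReM /= mulr0 subr0.
    by [].
  rewrite ler_pdivrMr//; apply: le_trans (ler_norm _) _.
  apply: le_trans (HB z zn0) _; rewrite ler_peMr ?ler1n//.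
  exact: le_trans (HB z zn0).
have := liouville_punctured phi _ dphi bphi z0 z1 z00 z10.
move=> /cexp_inj => H; have {}H : h z0 / N%:R = h z1 / N%:R.
  apply: H; rewrite -ImB -mulrBl; apply: le_lt_trans (normc_Im _) _.
  rewrite normcM normcV normc_nat ltr_pdivrMr//.
  apply: lt_le_trans (archi_boundP (normc_ge0 _)) _; rewrite -/N.
  rewrite ler_peMl ?(ltW Nr)//; have := @pi_ge2 R; rewrite mulr2n; lra.
by apply: (mulIf _ H); rewrite invr_eq0.
Qed.

End PuncturedPlaneAutomorphism.

(** * Differentiability is a local property *)

Section NearDifferentiable.
Context {K : numFieldType} {V W : normedModType K}.

Lemma differentiable_near0 (h : V -> W) (x : V) :
  (\forall y \near x, h y = 0) -> differentiable h x.
Proof.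
move=> h0; have hx : h x = 0 by exact: nbhs_singleton h0.
have c0 : continuous (\0 : {linear V -> W}) by move=> y; exact: cst_continuous.
have E : h \o shift x = cst (h x) + (\0 : {linear V -> W}) +o_ (0 : V) id.
  apply/eqaddoP => e e0; near=> y.
  suff -> : (h \o shift x - (cst (h x) + \0)) y = 0 by rewrite normr0 mulr_ge0// ltW.
  rewrite !fctE/= hx addr0 subr0.
  near: y; have : (y + x @[y --> (0 : V)] --> 0 + x).
    by apply: cvgD; [exact: cvg_id|exact: cvg_cst].
  by rewrite add0r => /(_ _ h0).
by apply/diff_locallyP; rewrite (diff_unique c0 E).
Unshelve. all: by end_near. Qed.

Lemma differentiable_near (f g : V -> W) (x : V) :
  (\forall y \near x, f y = g y) -> differentiable g x -> differentiable f x.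
Proof.
move=> fg dg; have -> : f = g + (f - g) by rewrite addrC subrK.
apply: differentiableD => //; apply: differentiable_near0.
by apply: filterS fg => y fgy; rewrite !fctE fgy subrr.
Qed.

End NearDifferentiable.

(** * The principal logarithm *)

Section PrincipalLogarithm.
Context {R : realType}.
Implicit Types z w : R[i].

Definition plog z : R[i] :=
  (ln (normc z) +i* atan (complex.Im z / complex.Re z))%C.

Lemma cexp_plog z : 0 < complex.Re z -> cexp (plog z) = z.
Proof.
move=> z0; set t := complex.Im z / complex.Re z.
have c0 : 0 < cos (atan t).
  by apply: cos_gt0_pihalf; rewrite atan_gtNpi2 atan_ltpi2.
have ts : sin (atan t) = t * cos (atan t).
  by have := atanK t; rewrite /tan => {2}<-; rewrite divfK// gt_eqF.
have tz : complex.Im z = t * complex.Re z by rewrite /t divfK// gt_eqF.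
have nz : 0 < normc z by apply: lt_le_trans (normc_Re z); rewrite normr_gt0 gt_eqF.
have n2 : normc z ^+ 2 = complex.Re z ^+ 2 * (1 + t ^+ 2).
  have -> : normc z ^+ 2 = complex.Re z ^+ 2 + complex.Im z ^+ 2.
    by case: (z) => a b /=; rewrite sqr_sqrtr// addr_ge0// sqr_ge0.
  by rewrite tz; ring.
have c2 : cos (atan t) ^+ 2 * (1 + t ^+ 2) = 1.
  by have := cos2Dsin2 (atan t); rewrite ts => h; rewrite -[RHS]h; ring.
have key : normc z * cos (atan t) = complex.Re z.
  apply/eqP; rewrite -(@eqrXn2 _ 2)// ?mulr_ge0 ?ltW//.
  by rewrite exprMn n2 -mulrA [_ * (cos _ ^+ 2)]mulrC c2 mulr1.
apply: complex_eq; rewrite ?(Re_cexp, Im_cexp)/= lnK ?posrE// -/t.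
by rewrite ts mulrCA key -tz.
Qed.

Lemma Im_plog z : `|complex.Im (plog z)| < pi / 2.
Proof. by rewrite ltr_norml atan_gtNpi2 atan_ltpi2. Qed.

Lemma plog_unique z w : 0 < complex.Re z -> cexp w = z ->
  `|complex.Im w| < pi -> w = plog z.
Proof.
move=> z0 wz wp; apply: cexp_inj; first by rewrite cexp_plog.
have := Im_plog z; have := @pi_gt0 R; rewrite [pi *+ 2]mulr2n => p0 zp.
by apply: le_lt_trans (ler_normB _ _) _; lra.
Qed.

Lemma plogM z w : 0 < complex.Re z -> 0 < complex.Re w ->
  0 < complex.Re (z * w) -> plog (z * w) = plog z + plog w.
Proof.
move=> z0 w0 zw0; apply/esym/plog_unique => //; first by rewrite cexpD !cexp_plog.
rewrite ImD; apply: le_lt_trans (ler_normD _ _) _.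
by have := Im_plog z; have := Im_plog w; lra.
Qed.

Lemma plog1 : plog 1 = 0.
Proof. by rewrite /plog normc1 ln1 /= mul0r atan0. Qed.

Lemma Re_gt0_near1 z : normc (z - 1) < 1 -> 0 < complex.Re z.
Proof.
move=> z1; have := le_lt_trans (normc_Re _) z1.
by rewrite ReB/= ltr_norml => /andP[+ _]; lra.
Qed.

Lemma continuous_normcP (u : R[i]^o -> R) (z : R[i]^o) :
  {for z, continuous u} <-> forall e, 0 < e ->
    exists2 d, 0 < d & forall w, normc (w - z) < d -> `|u w - u z| < e.
Proof.
split=> [cu e e0|H A /nbhs_ballP[e /= e0 HA]].
  have : nbhs (u z) [set t | `|t - u z| < e].
    by apply/nbhs_ballP; exists e => // t; rewrite /ball/= distrC.
  by move=> /cu/nbhs_normcP.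
have [d d0 Hd] := H _ e0; apply/nbhs_normcP; exists d => // w /Hd h.
by apply: HA; rewrite /ball/= distrC.
Qed.

Lemma ccont_plog z : 0 < complex.Re z -> ccont plog z.
Proof.
move=> z0; have nz : 0 < normc z by apply: lt_le_trans (normc_Re z); rewrite normr_gt0 gt_eqF.
have cRe : continuous (fun z : R[i]^o => complex.Re z : R).
  move=> w; apply/continuous_normcP => e e0; exists e => // v vw.
  by rewrite -ReB; exact: le_lt_trans (normc_Re _) vw.
have cIm : continuous (fun z : R[i]^o => complex.Im z : R).
  move=> w; apply/continuous_normcP => e e0; exists e => // v vw.
  by rewrite -ImB; exact: le_lt_trans (normc_Im _) vw.
have cN : continuous (fun z : R[i]^o => normc z : R).
  move=> w; apply/continuous_normcP => e e0; exists e => // v vw.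
  apply: le_lt_trans vw; rewrite ler_norml lerNl opprB normcB_ge andbT.
  by rewrite normc_distC normcB_ge.
have c1 : {for (z : R[i]^o), continuous (fun z : R[i]^o => ln (normc z))}.
  by apply: (@continuous_comp _ _ _ (fun z : R[i]^o => normc z)); [exact: cN|exact: continuous_ln].
have c2 : {for (z : R[i]^o), continuous
    (fun z : R[i]^o => atan (complex.Im z / complex.Re z))}.
  apply: (@continuous_comp _ _ _ (fun z : R[i]^o => complex.Im z / complex.Re z)).
    have a1 : complex.Im v @[v --> (z : R[i]^o)] --> complex.Im z := cIm z.
    have a2 : (complex.Re v)^-1 @[v --> (z : R[i]^o)] --> (complex.Re z)^-1.
      have zn : complex.Re z != 0 by exact: lt0r_neq0.
      have h : complex.Re v @[v --> (z : R[i]^o)] --> complex.Re z := cRe z.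
      exact: cvgV zn h.
    exact: cvgM a1 a2.
  exact: continuous_atan.
move=> e e0; have e20 : 0 < e / 2 by lra.
have [d1 d10 H1] := (continuous_normcP _ _).1 c1 _ e20.
have [d2 d20 H2] := (continuous_normcP _ _).1 c2 _ e20.
exists (Num.min d1 d2); first by rewrite lt_min d10.
move=> w; rewrite lt_min => /andP[/H1 {}H1 /H2 {}H2].
apply: le_lt_trans (normc_le_ReIm _) _; rewrite ReB ImB /=; lra.
Qed.

(** [plog] inverts [cexp], whose derivative at 0 is 1. *)
Lemma cdiff_plog1 : cdiff plog 1.
Proof.
exists 1 => e e0; pose e1 := Num.min (1 / 2) (e / 2).
have e10 : 0 < e1 by rewrite lt_min !divr_gt0.
have [e12 e1e] : e1 <= 1 / 2 /\ e1 <= e / 2 by rewrite !ge_min !lexx orbT.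
clearbody e1.
have [d d0 H] := @cexp_o0 R _ e10.
have r1 : 0 < complex.Re (1 : R[i]) by exact: ltr01.
have [d' d'0 H'] := ccont_plog 1 r1 _ d0.
exists (Num.min 1 d'); first by rewrite lt_min ltr01.
move=> w; rewrite lt_min => /andP[/Re_gt0_near1 w0 /H']; rewrite plog1 !subr0 mul1r => /H.
rewrite cexp_plog// => h.
have A : normc (plog w) <= 2 * normc (w - 1).
  have := normcB_ge (plog w) (w - 1); rewrite normc_distC.
  have : e1 * normc (plog w) <= 1 / 2 * normc (plog w) by rewrite ler_wpM2r ?normc_ge0.
  by lra.
rewrite (normc_distC (plog w)); apply: le_trans h _.
apply: le_trans (_ : e1 * (2 * normc (w - 1)) <= _); first by rewrite ler_pM2l.
rewrite mulrA ler_wpM2r ?normc_ge0//; lra.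
Qed.

End PrincipalLogarithm.

(** * Holomorphic logarithms on star-shaped sets *)

Section LogarithmLifting.
Context {R : realType} {V : normedModType R[i]}.
Context (a : V -> R[i]^o).

Definition ray (x : V) (t : R) : R[i] := a (t%:C%C *: x).

(** The strict inequality puts the ratio of the two values of [a] in the open
    right half-plane, where [plog] is continuous and, by [plogM], additive on
    products that stay there. *)
Definition fine_step x n := forall s t : R, 0 <= s <= 1 ->
  `|t - s| <= (2 ^+ n)^-1 -> normc (ray x t - ray x s) < normc (ray x s).

Lemma fine_step_le x n m : (n <= m)%N -> fine_step x n -> fine_step x m.
Proof.
move=> nm H s t s01 st; apply: H => //; apply: le_trans st _.
by rewrite lef_pV2 ?posrE ?exprn_gt0// ler_eXn2l// ltr1n.
Qed.

Lemma fine_step_neq0 x n s : fine_step x n -> 0 <= s <= 1 -> ray x s != 0.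
Proof.
move=> H s01; have := H s s s01; rewrite !subrr normr0 normc0 normc_gt0; apply.
by rewrite invr_ge0 exprn_ge0.
Qed.

Lemma fine_step_Re x n s t : fine_step x n -> 0 <= s <= 1 ->
  `|t - s| <= (2 ^+ n)^-1 -> 0 < complex.Re (ray x t / ray x s).
Proof.
move=> H s01 st; have r0 := fine_step_neq0 _ _ _ H s01.
apply: Re_gt0_near1; have -> : ray x t / ray x s - 1 = (ray x t - ray x s) / ray x s.
  by rewrite mulrBl divff.
by rewrite normcM normcV ltr_pdivrMr ?normc_gt0// mul1r; exact: H.
Qed.

Definition grid n (k : nat) : R := k%:R / 2 ^+ n.

(** The variation along the ray from 0 to x of a logarithm of [a]. *)
Definition log_increment x n : R[i] :=
  \sum_(k < 2 ^ n) plog (ray x (grid n k.+1) / ray x (grid n k)).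

Lemma grid01 n k : (k <= 2 ^ n)%N -> 0 <= grid n k <= 1.
Proof.
move=> kn; rewrite divr_ge0 ?exprn_ge0//= ler_pdivrMr ?exprn_gt0// mul1r.
by rewrite -natrX ler_nat.
Qed.

Lemma gridS n k : grid n k.+1 - grid n k = (2 ^+ n)^-1.
Proof. by rewrite /grid -mulrBl -natr1 addrAC subrr add0r mul1r. Qed.

Lemma grid_double n k : grid n.+1 k.*2 = grid n k.
Proof.
rewrite /grid -muln2 natrM exprS; field.
by rewrite expf_neq0.
Qed.

Lemma gridS_abs n k : `|grid n k.+1 - grid n k| <= (2 ^+ n)^-1.
Proof. by rewrite gridS ger0_norm// invr_ge0 exprn_ge0. Qed.

Lemma sum_double (F : nat -> R[i]) m :
  \sum_(k < m.*2) F k = \sum_(k < m) (F k.*2 + F k.*2.+1).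
Proof.
elim: m => [|m IH]; first by rewrite !big_ord0.
by rewrite doubleS !big_ord_recr/= IH addrA.
Qed.

(** Each ratio over a step is the product of the ratios over its two halves,
    and all three lie in the right half-plane. *)
Lemma log_increment_double x n : fine_step x n ->
  log_increment x n.+1 = log_increment x n.
Proof.
move=> H; have H' := fine_step_le _ _ _ (leqnSn n) H.
rewrite /log_increment expnS mul2n.
rewrite (sum_double (fun k => plog (ray x (grid n.+1 k.+1) / ray x (grid n.+1 k)))).
apply: eq_bigr => -[k kn] _ /=.
have k1 : 0 <= grid n.+1 k.*2 <= 1.
  by apply: grid01; rewrite expnS mul2n leq_double ltnW.
have k2 : 0 <= grid n.+1 k.*2.+1 <= 1.
  by apply: grid01; rewrite expnS mul2n ltn_double.
have k3 : 0 <= grid n k <= 1 by apply: grid01; exact: ltnW.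
have E : ray x (grid n k.+1) / ray x (grid n k) =
    ray x (grid n.+1 k.*2.+1) / ray x (grid n.+1 k.*2) *
    (ray x (grid n.+1 k.*2.+2) / ray x (grid n.+1 k.*2.+1)).
  have n2 := fine_step_neq0 _ _ _ H' k2; have n3 := fine_step_neq0 _ _ _ H k3.
  by rewrite -doubleS !grid_double; field; rewrite n2 n3.
have g0 := fine_step_Re _ _ _ _ H k3 (gridS_abs n k).
have g1 := fine_step_Re _ _ _ _ H' k1 (gridS_abs n.+1 k.*2).
have g2 := fine_step_Re _ _ _ _ H' k2 (gridS_abs n.+1 k.*2.+1).
by rewrite E in g0 *; rewrite [RHS]plogM.
Qed.

Lemma log_increment_le x n m : (n <= m)%N -> fine_step x n ->
  log_increment x m = log_increment x n.
Proof.
move=> /subnK <- H; elim: (m - n)%N => [//|k IH].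
by rewrite addSn log_increment_double//; exact: fine_step_le (leq_addl k n) H.
Qed.

Lemma log_increment_unique x n m : fine_step x n -> fine_step x m ->
  log_increment x m = log_increment x n.
Proof.
move=> Hn Hm; case: (leqP n m) => [nm|/ltnW mn]; first exact: log_increment_le.
by rewrite (log_increment_le _ _ _ mn).
Qed.

Lemma cexp_log_increment x n : fine_step x n ->
  cexp (log_increment x n) = a x / a 0.
Proof.
move=> H; have key m : (m <= 2 ^ n)%N ->
    cexp (\sum_(k < m) plog (ray x (grid n k.+1) / ray x (grid n k)))
      = ray x (grid n m) / ray x (grid n 0).
  elim: m => [_|m IH mn].
    rewrite big_ord0 cexp0 divff// (fine_step_neq0 _ _ _ H)//.
    by rewrite /grid mul0r lexx ler01.
  have m01 := grid01 _ _ (ltnW mn).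
  rewrite big_ord_recr/= cexpD IH ?(ltnW mn)// cexp_plog; last first.
    exact: (fine_step_Re _ _ _ _ H m01 (gridS_abs n m)).
  have rn := fine_step_neq0 _ _ _ H m01.
  by rewrite mulrC mulrA divfK.
rewrite key// /grid natrX divff ?expf_neq0// mul0r /ray.
by rewrite rmorph1 rmorph0 scale1r scale0r.
Qed.

Lemma real_complex_continuous : continuous (fun s : R => s%:C%C : R[i]^o).
Proof.
move=> s A /nbhs_normcP[e e0 HA]; apply/nbhs_ballP; exists e => // t st.
by apply: HA; rewrite -rmorphB normc_real distrC.
Qed.

Lemma ray_continuous (s : R) (x : V) : {for s%:C%C *: x, continuous a} ->
  (fun p : R * V => ray p.2 p.1 : R[i]^o) p @[p --> (s, x)] --> a (s%:C%C *: x).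
Proof.
move=> ca; rewrite /ray.
have h : p.1%:C%C *: p.2 @[p --> (s, x)] --> s%:C%C *: x.
  have h1 : (p.1%:C%C : R[i]^o) @[p --> (s, x)] --> (s%:C%C : R[i]^o).
    apply: (@continuous_comp _ _ _ fst (fun s : R => s%:C%C : R[i]^o) (s, x)).
      exact: cvg_fst.
    exact: real_complex_continuous.
  by apply: (cvgZ h1); exact: cvg_snd.
exact: cvg_comp h ca.
Qed.

(** By compactness of [0, 1] it suffices to control points of rays close to a
    given point s x0; there [a] moves by less than a third of its modulus. *)
Lemma fine_step_near x0 :
  (forall s, 0 <= s <= 1 -> {for s%:C%C *: x0, continuous a} /\ ray x0 s != 0) ->
  exists n, \forall x \near x0, fine_step x n.
Proof.
move=> H; have := @segment_compact R 0 1 => /compact_near_coveringP.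
move=> /(_ (V * R)%type (nbhs ((x0, 0) : V * R))
   (fun p s => normc (ray p.1 (s + p.2) - ray p.1 s) < normc (ray p.1 s)) _).
case.
  move=> s; rewrite /= in_itv/= => /H[cs s0].
  pose e := normc (ray x0 s) / 3; have e0 : 0 < e by rewrite divr_gt0// normc_gt0.
  have : nbhs (a (s%:C%C *: x0)) [set w : R[i]^o | normc (w - ray x0 s) < e].
    by apply/nbhs_normcP; exists e.
  move=> /(ray_continuous s x0 cs)[[/= A B] [/nbhs_ballP[d /= d0 HA] HB] AB].
  exists (ball s (d / 2), (B `*` ball (0 : R) (d / 2))) => /=.
    split; first by apply: nbhsx_ballx; rewrite divr_gt0.
    exists (B, ball (0 : R) (d / 2)) => //; split => //=.
    by apply: nbhsx_ballx; rewrite divr_gt0.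
  move=> [s' [x h]] [/= hs' [hx hh]].
  rewrite /ball/= distrC in hs'; rewrite /ball/= sub0r normrN in hh.
  have A1 : A s' by apply: HA; rewrite /ball/= distrC; lra.
  have A2 : A (s' + h).
    apply: HA; rewrite /ball/= distrC.
    have -> : s' + h - s = (s' - s) + h by ring.
    by apply: le_lt_trans (ler_normD _ _) _; lra.
  have /= E1 := AB (s', x) (conj A1 hx); have /= E2 := AB (s' + h, x) (conj A2 hx).
  have -> : ray x (s' + h) - ray x s' =
    (ray x (s' + h) - ray x0 s) - (ray x s' - ray x0 s) by ring.
  apply: le_lt_trans (normcB _ _) _.
  have := normcB_ge (ray x0 s) (ray x s'); rewrite normc_distC.
  have : normc (ray x0 s) = 3 * e by rewrite /e; field.
  by lra.
move=> [/= B T] [hB /nbhs_ballP[d /= d0 HT]] HBT.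
have [n nd] : exists n, (2 ^+ n)^-1 < d.
  exists (Num.bound d^-1); rewrite -[ltRHS]invrK ltf_pV2 ?posrE ?invr_gt0 ?exprn_gt0//.
  apply: lt_trans (archi_boundP _) _; first by rewrite invr_ge0 ltW.
  by rewrite -natrX ltr_nat ltn_expl.
exists n; apply: filterS hB => x Bx s t s01 st.
have Td : T (t - s) by apply: HT; rewrite /ball/= sub0r normrN; exact: le_lt_trans nd.
have := HBT (x, t - s) (conj Bx Td) s; rewrite /= addrCA subrr addr0; apply.
by rewrite in_itv.
Qed.

Lemma log_increment_continuous x0 n : fine_step x0 n ->
  (forall s, 0 <= s <= 1 -> {for s%:C%C *: x0, continuous a}) ->
  {for x0, continuous (fun x => log_increment x n : R[i]^o)}.
Proof.
move=> H ca.
have cr s : 0 <= s <= 1 -> ray x s @[x --> x0] --> (ray x0 s : R[i]^o).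
  move=> s01; apply: (@continuous_comp _ _ _ (fun x : V => s%:C%C *: x) a x0 _ (ca s s01)).
  exact: scaler_continuous.
pose F k x : R[i]^o := plog (ray x (grid n k.+1) / ray x (grid n k)).
have cF k : (k < 2 ^ n)%N -> F k x @[x --> x0] --> F k x0.
  move=> kn; have k1 := grid01 _ _ (ltnW kn).
  have r1 := fine_step_Re _ _ _ _ H k1 (gridS_abs n k).
  have rn : (ray x0 (grid n k) : R[i]^o) != 0 := fine_step_neq0 _ _ _ H k1.
  apply: (@continuous_comp _ _ _
    (fun x => ray x (grid n k.+1) / ray x (grid n k) : R[i]^o)
    (plog : R[i]^o -> R[i]^o)); last by apply/ccontP; exact: ccont_plog.
  exact: cvgM (cr _ (grid01 _ _ kn)) (cvgV rn (cr _ k1)).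
suff key m : (m <= 2 ^ n)%N ->
    \sum_(k < m) F k x @[x --> x0] --> \sum_(k < m) F k x0 by exact: key.
elim: m => [_|m IH mn].
  by rewrite big_ord0; under eq_fun do rewrite big_ord0; exact: cvg_cst.
rewrite big_ord_recr; under eq_fun do rewrite big_ord_recr.
exact: cvgD (IH (ltnW mn)) (cF m mn).
Qed.

(** By continuity f stays on one branch near x0, where it is therefore equal to
    f x0 + plog (a / a x0). *)
Lemma differentiable_log (f : V -> R[i]^o) x0 : {for x0, continuous f} ->
  (\forall x \near x0, cexp (f x) = a x) -> differentiable a x0 ->
  differentiable f x0.
Proof.
move=> cf fa da; have fa0 : cexp (f x0) = a x0 by exact: nbhs_singleton fa.
have a0 : (a x0 : R[i]) != 0 by rewrite -fa0 cexp_neq0.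
have ca : {for x0, continuous a} by exact: differentiable_continuous.
apply: (@differentiable_near _ _ _ _ (fun x => f x0 + plog (a x / a x0) : R[i]^o)).
  have n1 : \forall x \near x0, normc (f x - f x0) < 1.
    have b1 : nbhs (f x0) [set w : R[i]^o | normc (w - f x0) < 1].
      by apply/nbhs_normcP; exists 1.
    exact: cf b1.
  have n2 : \forall x \near x0, normc (a x - a x0) < normc (a x0 : R[i]).
    have b2 : nbhs (a x0) [set w : R[i]^o | normc (w - a x0) < normc (a x0 : R[i])].
      by apply/nbhs_normcP; exists (normc (a x0 : R[i])); rewrite // normc_gt0.
    exact: ca b2.
  apply: filterS3 fa n1 n2 => x fax fx ax.
  rewrite -(plog_unique (a x / a x0) (f x - f x0)); first by rewrite addrC subrK.
  - apply: Re_gt0_near1; rewrite -[1](divff a0) -mulrBl normcM normcV.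
    by rewrite ltr_pdivrMr ?normc_gt0// mul1r.
  - by rewrite cexpB fax fa0.
  - by apply: le_lt_trans (normc_Im _) (lt_trans fx _); have := @pi_ge2 R; lra.
apply: differentiableD; first exact: differentiable_cst.
apply: (@differentiable_comp _ _ R[i]^o R[i]^o (fun x => a x / a x0 : R[i]^o) plog).
  exact: (@differentiableM R[i] V a (fun=> (a x0)^-1) x0 da (differentiable_cst _ _)).
by apply/cdiffP; rewrite divff//; exact: cdiff_plog1.
Qed.

(** The logarithm at x is [log_increment] for any subdivision that is fine on
    the ray of x, and one subdivision is fine on all rays close to it. *)
Theorem holomorphic_log (D : set V) :
  (forall x (s : R), D x -> 0 <= s <= 1 -> D (s%:C%C *: x)) ->
  holomorphic_on D a -> (forall x, D x -> a x <> 0) ->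
  exists2 f : V -> R[i]^o, holomorphic_on D f & forall x, D x -> cexp (f x) = a x.
Proof.
move=> starD da a0; have [[z Dz]|D0] := pselect (exists x, D x); last first.
  by exists (fun=> 0) => x Dx; exfalso; apply: D0; exists x.
have DO : D 0 by rewrite -[0](scale0r z) -(rmorph0 (real_complex R)); apply: starD; rewrite ?lexx ?ler01.
have aO : (a 0 : R[i]) != 0 by apply/eqP/a0.
have [l [la _ _]] := cexp_surj _ aO.
have Hray x : D x -> forall s, 0 <= s <= 1 ->
    {for s%:C%C *: x, continuous a} /\ ray x s != 0.
  move=> Dx s s01; have Ds := starD _ _ Dx s01; split; last exact/eqP/a0.
  by apply: differentiable_continuous; exact: da.
pose N x := get [set n | fine_step x n].
pose f x : R[i]^o := l + log_increment x (N x).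
have fE x n : fine_step x n -> f x = l + log_increment x n.
  move=> H; rewrite /f; congr (_ + _); apply: log_increment_unique => //.
  by have := @getPex nat [set n | fine_step x n]; apply; exists n.
have fexp x n : fine_step x n -> cexp (f x) = a x.
  move=> H; rewrite (fE _ _ H) cexpD cexp_log_increment// la.
  by rewrite mulrC divfK.
exists f => x Dx; have [n nx] := fine_step_near x (Hray x Dx); last first.
  exact: fexp (nbhs_singleton nx).
apply: differentiable_log; last exact: da.
  have Hx := nbhs_singleton nx.
  have c1 : {for x, continuous (fun x => l + log_increment x n : R[i]^o)}.
    apply: (@continuousD R[i] R[i]^o V (fun=> l) _ x); first exact: cst_continuous.
    by apply: log_increment_continuous => // s s01; have [] := Hray x Dx s s01.
  suff cf : f y @[y --> x] --> f x by exact: cf.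
  rewrite (fE _ _ Hx); apply: cvg_trans c1; apply: near_eq_cvg.
  by apply: filterS nx => y /fE fy; exact: esym.
by apply: filterS nx => y /fexp.
Qed.

End LogarithmLifting.

(** * The spectral ball *)

Section SpectralBall.
Context {R : realType}.

Lemma eigenvalue_det n (x : 'M[R[i]]_n) l : eigenvalue x l = (\det (x - l%:M) == 0).
Proof.
by rewrite /eigenvalue /eigenspace kermx_eq0 row_free_unit unitmxE unitfE negbK.
Qed.

(** The spectrum is finite, so that the supremum of the moduli is attained; it
    is 0 if the spectrum is empty. *)
Lemma spectral_ballP n (x : 'M[R[i]]_n) :
  spectral_ball R n x <-> forall l, eigenvalue x l -> normc l < 1.
Proof.
have [rs rsE] : exists rs : seq R[i], forall l, eigenvalue x l = (l \in rs).
  have [rs E] := closed_field_poly_normal (char_poly x); exists rs => l.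
  rewrite eigenvalue_root_char E (monicP (char_poly_monic x)) scale1r.
  by rewrite root_prod_XsubC.
have -> : spectral_ball R n x <-> sup [set normc l | l in [set l : R[i] | eigenvalue x l]] < 1.
  rewrite /spectral_ball /spectral_radius /=.
  have -> : [set complex.Re `|l| | l in [set l : R[i] | eigenvalue x l]] =
    [set normc l | l in [set l : R[i] | eigenvalue x l]].
    by apply/seteqP; split=> _ [l xl <-]; exists l => //; rewrite normE.
  by [].
split=> [x1 l xl|x1].
  apply: le_lt_trans x1; apply: ub_le_sup; last by exists l.
  exists (\sum_(r <- rs) normc r) => _ [r + <-]; rewrite /= rsE => rrs.
  rewrite (big_rem r)//= lerDl; apply: sumr_ge0 => r' _; exact: normc_ge0.
have [M [M0 M1 HM]] : exists M : R, [/\ 0 <= M, M < 1 & forall l, l \in rs -> normc l <= M].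
  have : forall l, l \in rs -> normc l < 1 by move=> l; rewrite -rsE; exact: x1.
  elim: rs {rsE} => [|r rs IH] H; first by exists 0.
  have [|M [M0 M1 HM]] := IH; first by move=> l lrs; apply: H; rewrite inE lrs orbT.
  exists (Num.max M (normc r)); rewrite le_max M0 gt_max M1 H ?mem_head//.
  split => // l; rewrite inE le_max => /predU1P[->|/HM ->//]; by rewrite lexx orbT.
have [[l xl]|no] := pselect (exists l, eigenvalue x l).
  apply: le_lt_trans M1; apply: ge_sup; first by exists (normc l), l.
  by move=> _ [r + <-]; rewrite /= rsE; exact: HM.
have -> : [set normc l | l in [set l : R[i] | eigenvalue x l]] = set0.
  by apply/seteqP; split => // t [l xl _]; exfalso; apply: no; exists l.
by rewrite sup0.
Qed.

Lemma eigenvalue_mx2 (x : 'M[R[i]]_2) l : eigenvalue x l =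
  ((x 0 0 - l) * (x 1 1 - l) - x 0 1 * x 1 0 == 0).
Proof.
rewrite eigenvalue_det (expand_det_row _ 0) !big_ord_recl big_ord0.
rewrite /cofactor !det_mx11 !mxE/= !expr0 !expr1.
have -> : lift 0 0 = 1 :> 'I_2 by apply/val_inj.
have -> : lift 1 0 = 0 :> 'I_2 by apply/val_inj.
by rewrite !mulr1n !mulr0n; congr (_ == 0); ring.
Qed.

(** These three quantities determine the characteristic polynomial. *)
Lemma spectral_ball2_eq (x y : 'M[R[i]]_2) :
  x 0 0 = y 0 0 -> x 1 1 = y 1 1 -> x 0 1 * x 1 0 = y 0 1 * y 1 0 ->
  spectral_ball R 2 x -> spectral_ball R 2 y.
Proof.
move=> e0 e1 e2 /spectral_ballP Hx; apply/spectral_ballP => l yl.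
by apply: Hx; move: yl; rewrite !eigenvalue_mx2 e0 e1 e2.
Qed.

Lemma spectral_ball2_star (x : 'M[R[i]]_2) (s : R) :
  spectral_ball R 2 x -> 0 <= s <= 1 -> spectral_ball R 2 (s%:C%C *: x).
Proof.
move=> /spectral_ballP Hx /andP[s0 s1]; apply/spectral_ballP => l.
rewrite eigenvalue_mx2 !mxE; have [->|sn0] := eqVneq s 0.
  rewrite rmorph0 !mul0r subr0 sub0r mulrNN mulf_eq0 orbb => /eqP ->.
  by rewrite normc0.
have sc : s%:C%C != 0 :> R[i] by rewrite -normc_gt0 normc_real normr_gt0.
move=> H; have : eigenvalue x (l / s%:C%C).
  rewrite eigenvalue_mx2; move: H; set c := s%:C%C in sc *.
  have -> : (c * x 0 0 - l) * (c * x 1 1 - l) - c * x 0 1 * (c * x 1 0) =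
    c ^+ 2 * ((x 0 0 - l / c) * (x 1 1 - l / c) - x 0 1 * x 1 0) by field.
  by rewrite mulf_eq0 expf_eq0/= (negbTE sc).
move=> /Hx; rewrite normcM normcV normc_real ger0_norm// ltr_pdivrMr; last first.
  by rewrite lt_def sn0.
by rewrite mul1r => /lt_le_trans; apply.
Qed.

End SpectralBall.

(** * The torus action *)

Section TorusAction.
Context {R : realType}.
Implicit Types (x y : 'M[R[i]]_2) (z w c : R[i]).

Lemma mx2P x y : x 0 0 = y 0 0 -> x 0 1 = y 0 1 -> x 1 0 = y 1 0 ->
  x 1 1 = y 1 1 -> x = y.
Proof.
move=> e00 e01 e10 e11; apply/matrixP.
have ord2 (i : 'I_2) : i = 0 \/ i = 1.
  by case: i => [[|[|//]] hi]; [left|right]; apply/val_inj.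
by move=> i j; case: (ord2 i) => ->; case: (ord2 j) => ->.
Qed.

Definition mx2 (p q r s : R[i]) : 'M[R[i]]_2 :=
  \matrix_(i, j) if i == 0 then (if j == 0 then p else q) else (if j == 0 then r else s).

Definition torus z x := mx2 (x 0 0) (z * x 0 1) (z^-1 * x 1 0) (x 1 1).

Lemma torusM z w x : torus z (torus w x) = torus (z * w) x.
Proof. by apply: mx2P; rewrite !mxE//= ?invfM mulrA. Qed.

Lemma torus1 x : torus 1 x = x.
Proof. by apply: mx2P; rewrite !mxE//= ?invr1 mul1r. Qed.

Lemma torus_spectral_ball z x : z != 0 -> spectral_ball R 2 x ->
  spectral_ball R 2 (torus z x).
Proof.
move=> z0; apply: spectral_ball2_eq; rewrite !mxE//=.
by rewrite mulrACA divff// mul1r.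
Qed.

Lemma Dtilde_torus a x : (a x : R[i]) != 0 -> Dtilde a x = torus (a x ^+ 2) x.
Proof.
move=> a0; rewrite /Dtilde; set c : R[i] := a x in a0 *.
have inv : diag_inv c *m diag_inv c^-1 = 1%:M.
  rewrite /diag_inv; apply: mx2P; rewrite mul_diag_mx !mxE/=.
  - by rewrite mulr1n divff.
  - by rewrite mulr0n mulr0.
  - by rewrite mulr0n mulr0.
  - by rewrite mulr1n invrK mulVf.
have u : diag_inv c \in unitmx by case: (mulmx1_unit inv).
have -> : invmx (diag_inv c) = diag_inv c^-1 by rewrite -[RHS](mulKmx u) inv mulmx1.
rewrite /diag_inv mul_diag_mx mul_mx_diag; apply: mx2P; rewrite !mxE/=.
- by field.
- by rewrite invrK; ring.
- by field.
- by rewrite invrK; field.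
Qed.

Lemma differentiable_id (z : R[i]^o) : differentiable (fun w : R[i]^o => w) z.
Proof. by have [+ _] := cdiffP id z; apply; exact: cdiff_id. Qed.

Lemma differentiable_torus x z : z != 0 ->
  differentiable (fun w : R[i]^o => torus w x) (z : R[i]^o).
Proof.
move=> z0.
have -> : (fun w : R[i]^o => torus w x) =
    (fun w : R[i]^o => mx2 (x 0 0) 0 0 (x 1 1) + w *: mx2 0 (x 0 1) 0 0
      + w^-1 *: mx2 0 0 (x 1 0) 0).
  by apply/funext => w; apply: mx2P; rewrite !mxE/= ?mulr0 ?addr0 ?add0r.
apply: differentiableD; last first.
  have dV := @differentiableV R[i] R[i]^o (fun w => w) z (differentiable_id z) z0.
  exact: (@differentiableZl R[i] R[i]^o _ _ _ z dV).
apply: differentiableD; first exact: differentiable_cst.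
exact: (@differentiableZl R[i] R[i]^o _ _ _ _ (differentiable_id _)).
Qed.

End TorusAction.

(** * Constancy on torus orbits *)

Section OrbitConstancy.
Context {R : realType}.
Implicit Types (x y : 'M[R[i]]_2) (z w : R[i]).

(** On the orbit of x, the map D is z |-> z exp (b (z.x)) and its inverse is
    z |-> z exp (- b (g (z.x))), so that [twist_inverse_constant] applies. *)
Lemma torus_orbit_constant (b : 'M[R[i]]_2 -> R[i]^o) (D g : 'M[R[i]]_2 -> 'M[R[i]]_2) :
  holomorphic_on (spectral_ball R 2) b ->
  holomorphic_on (spectral_ball R 2) g ->
  (forall x, spectral_ball R 2 x -> D x = torus (cexp (b x)) x) ->
  (forall x, spectral_ball R 2 x -> spectral_ball R 2 (g x)) ->
  (forall x, spectral_ball R 2 x -> g (D x) = x) ->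
  (forall x, spectral_ball R 2 x -> D (g x) = x) ->
  forall x z, spectral_ball R 2 x -> z != 0 -> b (torus z x) = b x.
Proof.
move=> db dg DE gO gD Dg x z Ox z0.
have Ot w : w != 0 -> spectral_ball R 2 (torus w x).
  by move=> w0; exact: torus_spectral_ball.
pose h w : R[i] := b (torus w x); pose k w : R[i] := - b (g (torus w x)).
have hE w : w != 0 -> D (torus w x) = torus (twist h w) x.
  move=> w0; rewrite (DE _ (Ot w w0)) torusM.
  by congr torus; exact: mulrC.
have kE w : w != 0 -> g (torus w x) = torus (twist k w) x.
  move=> w0; have Og := gO _ (Ot w w0).
  have := Dg _ (Ot w w0); rewrite (DE _ Og).
  move=> /(congr1 (torus (cexp (k w)))); rewrite !torusM.
  have -> : cexp (k w) * cexp (b (g (torus w x))) = 1.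
    by rewrite /k cexpN mulVf// cexp_neq0.
  rewrite torus1 => ->; by congr torus; exact: mulrC.
suff hk : twist_inverse h k.
  by have := twist_inverse_constant _ _ hk z 1 z0 (oner_neq0 _); rewrite /h torus1.
split=> w w0.
- apply/cdiffP; apply: (@differentiable_comp _ _ _ _ (fun w : R[i]^o => torus w x) b).
    exact: differentiable_torus.
  exact: db (Ot w w0).
- apply/cdiffP; apply: differentiableN.
  apply: (@differentiable_comp _ _ _ _ (fun w : R[i]^o => g (torus w x)) b).
    apply: (@differentiable_comp _ _ _ _ (fun w : R[i]^o => torus w x) g).
      exact: differentiable_torus.
    exact: dg (Ot w w0).
  exact: db (gO _ (Ot w w0)).
- have kh : k (twist h w) = - h w by rewrite /k -(hE w w0) (gD _ (Ot w w0)).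
  by rewrite {1}/twist kh cexpN /twist mulfK// cexp_neq0.
- have hk : h (twist k w) = - k w by rewrite /h -(kE w w0) /k opprK.
  by rewrite {1}/twist hk cexpN /twist mulfK// cexp_neq0.
Qed.

(** If x21 = 0, then z.x tends to the diagonal part of x when z tends to 0; if
    x12 = 0, it does so when z tends to infinity. *)
Lemma torus_limit_constant (b : 'M[R[i]]_2 -> R[i]^o) x :
  holomorphic_on (spectral_ball R 2) b ->
  (forall x z, spectral_ball R 2 x -> z != 0 -> b (torus z x) = b x) ->
  spectral_ball R 2 x -> x 0 1 * x 1 0 = 0 ->
  b x = b (mx2 (x 0 0) 0 0 (x 1 1)).
Proof.
move=> db bt Ox x0; set d := mx2 _ _ _ _.
have Od : spectral_ball R 2 d by apply: spectral_ball2_eq Ox; rewrite !mxE//= x0 mulr0.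
(* The curve d + z N is the orbit of x, parametrised by z or by 1 / z. *)
pose N := mx2 0 (x 0 1) (x 1 0) 0.
have bN z : z != 0 -> b (d + z *: N) = b x.
  move=> z0; have /orP[/eqP x01|/eqP x10] : (x 0 1 == 0) || (x 1 0 == 0).
      by rewrite -mulf_eq0 x0.
    rewrite -(bt x z^-1 Ox) ?invr_eq0//; congr b; apply: mx2P; rewrite !mxE/=.
    - by rewrite mulr0 addr0.
    - by rewrite x01 !mulr0 addr0.
    - by rewrite invrK add0r.
    - by rewrite mulr0 addr0.
  rewrite -(bt x z Ox)//; congr b; apply: mx2P; rewrite !mxE/=.
  - by rewrite mulr0 addr0.
  - by rewrite add0r.
  - by rewrite x10 !mulr0 addr0.
  - by rewrite mulr0 addr0.
have c0 : ccont (fun z => b (d + z *: N)) 0.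
  apply: cdiff_cont; apply/cdiffP.
  apply: (@differentiable_comp _ _ _ _ (fun z : R[i]^o => d + z *: N) b).
    apply: differentiableD; first exact: differentiable_cst.
    exact: (@differentiableZl R[i] R[i]^o _ _ _ _ (differentiable_id _)).
  by rewrite scale0r addr0; exact: db.
apply/eqP; rewrite -subr_eq0 -normc_eq0; apply: contraTT isT => Dn0.
have D0 : 0 < normc (b x - b d : R[i]) by rewrite lt_def Dn0 normc_ge0.
have [dl dl0 H] := c0 _ D0; have [z z0 zd] := small_point dl dl0.
by have := H z; rewrite subr0 bN// scale0r addr0 ltxx => /(_ zd).
Qed.

End OrbitConstancy.

Theorem mainTheorem4 (R : realType) (a : 'M[R[i]]_2 -> R[i]^o)
    (a_hol : holomorphic_on (spectral_ball R 2) a)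
    (a_neq0 : forall x, spectral_ball R 2 x -> a x <> 0)
    (Da_aut : holomorphic_automorphism (spectral_ball R 2) (Dtilde a)) :
  exists b : 'M[R[i]]_2 -> R[i]^o,
    [/\ holomorphic_on (spectral_ball R 2) b,
        forall x, spectral_ball R 2 x -> a x = cexp (b x / 2)
      & forall x y, spectral_ball R 2 x -> spectral_ball R 2 y ->
          x 0 0 = y 0 0 -> x 1 1 = y 1 1 ->
          x 0 1 * x 1 0 = y 0 1 * y 1 0 ->
          b x = b y].
Proof.
have [f df fa] := holomorphic_log a (spectral_ball R 2)
  (fun x s Ox s01 => spectral_ball2_star x s Ox s01) a_hol a_neq0.
pose b x : R[i]^o := 2 *: f x.
have db : holomorphic_on (spectral_ball R 2) b.
  by move=> x Ox; apply: differentiableZ; exact: df.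
have two : (2 : R[i]) != 0 by rewrite pnatr_eq0.
have bE x : spectral_ball R 2 x -> cexp (b x) = a x ^+ 2.
  by move=> Ox; rewrite /b /GRing.scale/= cexpMn fa.
have [_ [g [dg DO gO gD Dg]]] := Da_aut.
have bt : forall x z, spectral_ball R 2 x -> z != 0 -> b (torus z x) = b x.
  apply: (torus_orbit_constant b (Dtilde a) g) => // x Ox.
  - by rewrite bE// Dtilde_torus//; exact/eqP/a_neq0.
  - by apply: gD; rewrite inE.
  - by apply: Dg; rewrite inE.
exists b; split; first exact: db.
  by move=> x Ox; rewrite /b /GRing.scale/= mulrC mulKf// fa.
move=> x y Ox Oy e00 e11 em.
have [m0|m0] := eqVneq (x 0 1 * x 1 0) 0.
  have m0' : y 0 1 * y 1 0 = 0 by rewrite -em.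
  rewrite (torus_limit_constant b x db bt Ox m0).
  by rewrite (torus_limit_constant b y db bt Oy m0') e00 e11.
have [/norP[x01 x10] /norP[y01 y10]] :
    ~~ ((x 0 1 == 0) || (x 1 0 == 0)) /\ ~~ ((y 0 1 == 0) || (y 1 0 == 0)).
  by rewrite -!mulf_eq0 -em.
have z0 : y 0 1 / x 0 1 != 0 by rewrite mulf_neq0 ?invr_eq0.
rewrite -(bt x _ Ox z0); congr b.
have y10E : y 1 0 = x 0 1 * x 1 0 / y 0 1 by rewrite em mulrAC divff// mul1r.
apply: mx2P; rewrite !mxE/=.
- exact: e00.
- by rewrite divfK.
- by rewrite y10E; field; rewrite y01 x01.
- exact: e11.
Qed.
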